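(* Let $\tilde{H}$ be a graph on four vertices such that there is an algorithm which, given any graph $G$, counts the number of induced subgraphs of $G$ isomorphic to $\tilde{H}$ in time $O(t(G))$. Then there is an algorithm which, given a graph $G$ with $n$ vertices, $m$ edges and arboricity $\alpha(G)$, counts, for every graph $H$ on four vertices, the number of induced subgraphs of $G$ isomorphic to $H$, in time $O(n + \alpha(G)m + t(G))$.
   Context: All graphs are finite, simple and undirected. The arboricity $\alpha(G)$ is the minimum number of edge-disjoint spanning forests into which $E(G)$ can be decomposed. Here $t$ is a function assigning a nonnegative value to each graph. The graphs on four vertices (up to isomorphism) are the eleven graphs $K_4$, the diamond $K_4$ minus an edge, the square $C_4$, the path $P_4$, the paw (a triangle with a pendant vertex attached to one triangle vertex), the claw $K_{1,3}$, and the complements of $K_4$, the diamond, $C_4$, the paw and the claw. *)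

(* Defs.v *)
From HB Require Import structures.
From mathcomp Require Import all_boot all_order all_algebra.
From mathcomp Require Import reals.
Set Implicit Arguments.
Unset Strict Implicit.
Unset Printing Implicit Defensive.
Import Order.TTheory GRing.Theory Num.Theory.

(** * Graphs *)

Record sgraph (n : nat) := SGraph {
  edges : {set {set 'I_n}};
  edges_card2 : [forall e in edges, #|e| == 2] }.

HB.instance Definition _ n := [isSub for @edges n].
HB.instance Definition _ n := [Finite of sgraph n by <:].

Definition adj n (E : {set {set 'I_n}}) : rel 'I_n := [rel x y | [set x; y] \in E].

(** [ucycleb] alone accepts [:: x; y] for an edge xy, hence the condition
    on the length.  A repetition-free sequence has length at most [n]. *)
Definition is_forest n (E : {set {set 'I_n}}) : bool :=
  [forall k : 'I_n.+1, forall p : k.-tuple 'I_n,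
    (2 < k) ==> ~~ ucycleb (adj E) p].

Definition forest_decomposition n (G : sgraph n) k
    (F : {ffun 'I_k -> {set {set 'I_n}}}) : bool :=
  [&& [forall i, is_forest (F i)],
      [forall i, forall j, (i != j) ==> [disjoint F i & F j]]
    & \bigcup_i F i == edges G].

Definition forest_decomposable n (G : sgraph n) : pred nat :=
  fun k => [exists F : {ffun 'I_k -> {set {set 'I_n}}}, forest_decomposition G F].

Lemma forest_decomposable_ex n (G : sgraph n) : exists k, forest_decomposable G k.
Proof.
exists #|edges G|; apply/existsP.
exists [ffun i : 'I_#|edges G| => [set enum_val i]]; apply/and3P; split.
- apply/forallP=> i; rewrite ffunE; apply/forallP=> k; apply/forallP=> p.
  apply/implyP; case: p => -[|x [|y [|z p]]] /= /eqP <- //= _.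
  rewrite /ucycleb /adj /= !in_set1; apply/negP => /andP[/and3P[/eqP exy /eqP eyz _]].
  rewrite !inE !negb_or => /andP[/and3P[xy xz _] _].
  have: x \in [set y; z] by rewrite eyz -exy !inE eqxx.
  by rewrite !inE (negPf xy) (negPf xz).
- apply/forallP=> i; apply/forallP=> j; apply/implyP=> ij.
  by rewrite !ffunE disjoints1 inE (inj_eq enum_val_inj).
- apply/eqP/setP=> e; apply/bigcupP/idP=> [[i _]|eG].
    by rewrite ffunE inE => /eqP->; exact: enum_valP.
  exists (enum_rank_in eG e) => //.
  by rewrite ffunE enum_rankK_in // inE.
Qed.

Definition arboricity n (G : sgraph n) : nat := ex_minn (forest_decomposable_ex G).

(** The vertex sets [S] such that [G[S]] is isomorphic to [H]: [f] is an
    isomorphism from [H] onto [G[S]]. *)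
Definition induced_copies k n (H : sgraph k) (G : sgraph n) : {set {set 'I_n}} :=
  [set S | [exists f : {ffun 'I_k -> 'I_n},
     [&& injectiveb f, f @: [set: 'I_k] == S
       & [forall x, forall y, adj (edges H) x y == adj (edges G) (f x) (f y)]]]].

(** * Random access machine with uniform cost and logarithmic word length

    A program is a structured program over integer registers and
    zero-initialised integer arrays; registers and arrays are named by natural
    numbers.  Every operand, operator, memory access
    and command costs one unit.  All
    values produced during an execution must be at most a bound [B]: [eval]
    fails, and [exec] is stuck, when this is violated.  Below, [B] is a fixed
    power of [n + 2], where [n] is the order of the input graph, so that words
    have O(log n) bits. *)

Inductive binop := Add | Sub | Mul | Div | Mod | Eq | Lt.

(** Subtraction is truncated, division by zero yields [0]. *)
Definition binop_sem (o : binop) (a b : nat) : nat :=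
  match o with
  | Add => a + b
  | Sub => a - b
  | Mul => a * b
  | Div => a %/ b
  | Mod => a %% b
  | Eq => (a == b)
  | Lt => (a < b)
  end.

Inductive expr :=
  | Const of nat
  | Reg of nat
  | Get of nat & expr
  | Op of binop & expr & expr.

Inductive prog :=
  | Skip
  | Assign of nat & expr
  | Store of nat & expr & expr
  | Seq of prog & prog
  | If of expr & prog & prog
  | While of expr & prog.

Record state := State { reg : nat -> nat; arr : nat -> nat -> nat }.

Definition set_reg (s : state) (x v : nat) : state :=
  State (fun y => if y == x then v else reg s y) (arr s).

Definition set_arr (s : state) (a i v : nat) : state :=
  State (reg s)
    (fun b j => if (b == a) && (j == i) then v else arr s b j).

Definition fits (B v : nat) : option nat := if v <= B then Some v else None.

Fixpoint eval (B : nat) (s : state) (e : expr) : option nat :=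
  match e with
  | Const k => fits B k
  | Reg x => fits B (reg s x)
  | Get a e => if eval B s e is Some i then fits B (arr s a i) else None
  | Op o e1 e2 =>
    if eval B s e1 is Some a then
      if eval B s e2 is Some b then fits B (binop_sem o a b) else None
    else None
  end.

Fixpoint ecost (e : expr) : nat :=
  match e with
  | Const _ | Reg _ => 1
  | Get _ e => (ecost e).+1
  | Op _ e1 e2 => (ecost e1 + ecost e2).+1
  end.

(** [exec B p s k s']: from [s], the program [p] halts in [s'] at cost [k]. *)
Inductive exec (B : nat) : prog -> state -> nat -> state -> Prop :=
  | ExecSkip s : exec B Skip s 1 s
  | ExecAssign x e s v : eval B s e = Some v ->
      exec B (Assign x e) s (ecost e).+1 (set_reg s x v)
  | ExecStore a e1 e2 s i v : eval B s e1 = Some i -> eval B s e2 = Some v ->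
      exec B (Store a e1 e2) s (ecost e1 + ecost e2).+1 (set_arr s a i v)
  | ExecSeq p q s k s' l s'' : exec B p s k s' -> exec B q s' l s'' ->
      exec B (Seq p q) s (k + l) s''
  | ExecIfTrue e p q s v k s' : eval B s e = Some v -> v != 0 ->
      exec B p s k s' -> exec B (If e p q) s (ecost e + k).+1 s'
  | ExecIfFalse e p q s k s' : eval B s e = Some 0 ->
      exec B q s k s' -> exec B (If e p q) s (ecost e + k).+1 s'
  | ExecWhileTrue e p s v k s' l s'' : eval B s e = Some v -> v != 0 ->
      exec B p s k s' -> exec B (While e p) s' l s'' ->
      exec B (While e p) s (ecost e + k + l).+1 s''
  | ExecWhileFalse e p s : eval B s e = Some 0 ->
      exec B (While e p) s (ecost e).+1 s.

Lemma exec_det B p s k s' l s'' :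
  exec B p s k s' -> exec B p s l s'' -> k = l /\ s' = s''.
Proof.
move=> H; elim: H l s'' => {p s k s'}.
- by move=> s l s'' H; inversion H.
- by move=> x e s v ev l s'' H; inversion H; subst; split; congruence.
- by move=> a e1 e2 s i v ei ev l s'' H; inversion H; subst; split; congruence.
- move=> p q s k s' l s'' _ IHp _ IHq l' t H; inversion H; subst.
  by have [? ?] := IHp _ _ ltac:(eassumption); subst;
    have [? ?] := IHq _ _ ltac:(eassumption); subst.
- move=> e p q s v k s' ev /eqP v0 _ IHp l s'' H; inversion H; subst.
    by have [? ?] := IHp _ _ ltac:(eassumption); subst.
  by exfalso; congruence.
- move=> e p q s k s' ev _ IHq l s'' H; inversion H; subst.
    by exfalso; apply: (elimN eqP ltac:(eassumption)); congruence.
  by have [? ?] := IHq _ _ ltac:(eassumption); subst.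
- move=> e p s v k s' l s'' ev /eqP v0 _ IHp _ IHw l' t H; inversion H; subst.
    by have [? ?] := IHp _ _ ltac:(eassumption); subst;
    have [? ?] := IHw _ _ ltac:(eassumption); subst.
  by exfalso; congruence.
- move=> e p s ev l s'' H; inversion H; subst => //.
  by exfalso; apply: (elimN eqP ltac:(eassumption)); congruence.
Qed.

(** * Input by adjacency lists *)

(** The neighbours of a vertex may be listed in any order. *)
Definition adjacency_lists n (G : sgraph n) (nb : 'I_n -> seq 'I_n) : Prop :=
  forall v, uniq (nb v) /\ nb v =i [pred u | adj (edges G) v u].

(** Register 0 holds the number of vertices.  Array 1 holds the concatenation
    of the adjacency lists, and the list of vertex [v] occupies the cells from
    index [A_0[v]] included to index [A_0[v + 1]] excluded, where [A_0] is
    array 0.  Everything else is zero. *)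
Definition input_state n (nb : 'I_n -> seq 'I_n) : state :=
  State
    (fun x => if x == 0 then n else 0)
    (fun a i =>
       if a == 0 then nth 0 (mkseq (fun v => \sum_(u < n | u < v) size (nb u)) n.+1) i
       else if a == 1 then nth 0 [seq val u | u <- flatten [seq nb v | v <- enum 'I_n]] i
       else 0).

(** * Counting induced subgraphs in time O(f) *)

(** A single program [p] which, on every graph [G] given by any adjacency
    lists, halts within [C * f G] steps, with the number of induced copies of
    [H] in register [out H] for each [H] in the family [Hs]. *)
Definition counts_induced_in_time (R : realType) (k : nat) (Hs : {set sgraph k})
    (f : forall n, sgraph n -> R) : Prop :=
  exists (p : prog) (out : sgraph k -> nat) (c : nat) (C : R),
    (0 < C)%R /\
    forall (n : nat) (G : sgraph n) (nb : 'I_n -> seq 'I_n),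
      adjacency_lists G nb ->
      exists (time : nat) (s : state),
        [/\ exec ((n + 2) ^ c) p (input_state nb) time s,
            (time%:R <= C * f n G)%R
          & forall H, H \in Hs -> reg s (out H) = #|induced_copies H G|].

(* Main.v *)
Require Import Defs.
From mathcomp Require Import all_boot all_order all_algebra.
From mathcomp Require Import reals.
From mathcomp Require Import zify.
Set Implicit Arguments.
Unset Strict Implicit.
Unset Printing Implicit Defensive.

(** Counting the injective homomorphisms of each four-vertex graph [P] into [G]
    gives linear equations for the induced counts.  For the ten graphs other
    than [K_4] these numbers are obtained in time O(n + alpha m): they reduce to
    sums over vertices, over edges, over triangles and over paths [v u w] in
    which [u] precedes [v] in the order by degree.  The last kind of sum costs
    the sum of the degrees of the lower endpoints of all edges, which is at most
    [2 alpha m]: in a forest every edge can be charged to one of its endpoints,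
    distinct edges to distinct endpoints.  A 4-cycle is found from its highest
    vertex [v] and the opposite vertex [w], as a pair of paths from [v] to [w].

    Inclusion-exclusion over the non-edges of a graph expresses its induced
    count by the injective counts, in which only that of [K_4] is unknown.  The
    induced count of [Htilde] determines it: replace the non-edges of [Htilde]
    by edges one at a time; leaving the current pair unconstrained gives a count
    in which [K_4] does not occur, and which is the sum of the counts before and
    after the replacement.

    The given program runs on the untouched input, since the other code only
    writes to registers and arrays that it does not mention.  It takes at least
    one step, so that its running time absorbs the constants. *)

(** * Executions with bounded words and costs *)

(** The given program may overwrite its whole input, [n] included, and its running time is known
    only from the exact input state. Hence all other counting precedes it, the results wait under
    names beyond its own, and its run is transported to the modified state by a frame argument. The
    time bound leaves no room for a pass over an [n * n] table: a table can be addressed, but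
    neither initialised nor summed at the end. Sums of [t * (t - 1)] over the entries [t] are
    therefore updated at every increment of an entry. Word size is governed by two exponents: stored
    values stay at most [M ^ D], while intermediate results of an expression may reach [M ^ c].
    Subtraction is truncated, so each difference of counts rests on an identity in which the
    subtracted count is a summand. All these identities concern maps; the passage to vertex sets is
    a division by the number of automorphisms. *)

Lemma fits_leq B v w : fits B v = Some w -> v <= B /\ w = v.
Proof. by rewrite /fits; case: ifP => // h [<-]. Qed.

Lemma fits_id B v : v <= B -> fits B v = Some v.
Proof. by rewrite /fits => ->. Qed.

Lemma eval_leq B s e v : eval B s e = Some v -> v <= B.
Proof.
case: e => [k|x|a e|o e1 e2] /=.
- by case/fits_leq => h ->.
- by case/fits_leq => h ->.
- by case: (eval B s e) => // i /fits_leq[h ->].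
- by case: (eval B s e1) => // i; case: (eval B s e2) => // j /fits_leq[h ->].
Qed.

Lemma eval_mono B B' s e v : B <= B' -> eval B s e = Some v -> eval B' s e = Some v.
Proof.
move=> BB'; have fm a w : fits B a = Some w -> fits B' a = Some w.
  by case/fits_leq => h ->; rewrite fits_id // (leq_trans h).
elim: e v => [k|x|a e IHe|o e1 IH1 e2 IH2] v /=; try exact: fm.
- by case: (eval B s e) IHe => // i /(_ i erefl) ->; exact: fm.
- case: (eval B s e1) IH1 => // i /(_ i erefl) ->.
  by case: (eval B s e2) IH2 => // j /(_ j erefl) ->; exact: fm.
Qed.

(** Lets the given program, analysed for words up to [(n + 2) ^ c0], run under the larger bound of
    the combined program. *)
Lemma exec_mono B B' p s k s' : B <= B' -> exec B p s k s' -> exec B' p s k s'.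
Proof.
move=> BB'; elim=> {p s k s'}; intros; econstructor; try eassumption;
  by apply: eval_mono; eassumption.
Qed.

Lemma exec_gt0 B p s k s' : exec B p s k s' -> 0 < k.
Proof. by elim=> // ????????; lia. Qed.

(** One strict bound covers the names of registers and of arrays, so that a single shift makes both
    kinds of names fresh. *)
Fixpoint expr_bound (e : expr) : nat :=
  match e with
  | Const _ => 0
  | Reg x => x.+1
  | Get a e => maxn a.+1 (expr_bound e)
  | Op _ e1 e2 => maxn (expr_bound e1) (expr_bound e2)
  end.

Fixpoint prog_bound (p : prog) : nat :=
  match p with
  | Skip => 0
  | Assign x e => maxn x.+1 (expr_bound e)
  | Store a e1 e2 => maxn a.+1 (maxn (expr_bound e1) (expr_bound e2))
  | Seq p q => maxn (prog_bound p) (prog_bound q)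
  | If e p q => maxn (expr_bound e) (maxn (prog_bound p) (prog_bound q))
  | While e p => maxn (expr_bound e) (prog_bound p)
  end.

Definition agree_below b s1 s2 :=
  (forall r, r < b -> reg s1 r = reg s2 r) /\
  (forall a, a < b -> forall i, arr s1 a i = arr s2 a i).

Definition agree_above b s1 s2 :=
  (forall r, b <= r -> reg s1 r = reg s2 r) /\
  (forall a, b <= a -> forall i, arr s1 a i = arr s2 a i).

Lemma eval_agree B b s1 s2 e : agree_below b s1 s2 -> expr_bound e <= b ->
  eval B s1 e = eval B s2 e.
Proof.
case=> hr ha; elim: e => [k|x|a e IHe|o e1 IH1 e2 IH2] //=; rewrite ?geq_max.
- by move=> h; rewrite hr.
- by case/andP=> h1 h2; rewrite IHe //; case: eval => // i; rewrite ha.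
- by case/andP=> h1 h2; rewrite IH1 // IH2.
Qed.

(** Names from [b] on are neither read nor written by [p], so the run can be replayed from any state
    that agrees below [b], at the same cost. This carries the given program from the input state to
    the state left by the counting code, and preserves the totals stored there. *)
Lemma exec_frame B b p s1 k s1' s2 : exec B p s1 k s1' -> prog_bound p <= b ->
  agree_below b s1 s2 ->
  exists s2', [/\ exec B p s2 k s2', agree_below b s1' s2' & agree_above b s2' s2].
Proof.
move=> H; elim: H s2 => {p s1 k s1'}.
- move=> s s2 _ h; exists s2; split=> //; constructor.
- move=> x e s v ev s2 /=; rewrite geq_max => /andP[xb eb] h.
  exists (set_reg s2 x v); split.
  + by constructor; rewrite -(eval_agree _ h).
  + by case: h => hr ha; split=> [r rb|a ab i] /=; [case: ifP => // _; exact: hr | exact: ha].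
  + by split=> [r rb|//] /=; case: eqP => // ?; lia.
- move=> a e1 e2 s i v ei ev s2 /=; rewrite !geq_max => /and3P[ab b1 b2] h.
  exists (set_arr s2 a i v); split.
  + by constructor; rewrite -(eval_agree _ h).
  + case: h => hr ha; split=> [r rb|a' a'b j] /=; first exact: hr.
    by case: ifP => // _; exact: ha.
  + by split=> [//|a' a'b j] /=; case: eqP => // ?; lia.
- move=> p q s k s' l s'' _ IHp _ IHq s2 /=; rewrite geq_max => /andP[pb qb] h.
  have [t [e1 h1 [f1 g1]]] := IHp _ pb h; have [u [e2 h2 [f2 g2]]] := IHq _ qb h1.
  exists u; split=> //; first by econstructor; eassumption.
  by split=> [r rb|a ab i]; rewrite ?f2 ?f1 ?g2 ?g1.
- move=> e p q s v k s' ev v0 _ IHp s2 /=; rewrite !geq_max => /and3P[eb pb qb] h.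
  have [t [e1 h1 g1]] := IHp _ pb h; exists t; split=> //.
  by apply: ExecIfTrue v0 e1; rewrite -(eval_agree _ h).
- move=> e p q s k s' ev _ IHq s2 /=; rewrite !geq_max => /and3P[eb pb qb] h.
  have [t [e1 h1 g1]] := IHq _ qb h; exists t; split=> //.
  by apply: ExecIfFalse e1; rewrite -(eval_agree _ h).
- move=> e p s v k s' l s'' ev v0 _ IHp _ IHw s2 /= hb h.
  move: (hb); rewrite geq_max => /andP[eb pb].
  have [t [e1 h1 [f1 g1]]] := IHp _ pb h; have [u [e2 h2 [f2 g2]]] := IHw _ hb h1.
  exists u; split=> //; first by apply: ExecWhileTrue v0 e1 e2; rewrite -(eval_agree _ h).
  by split=> [r rb|a ab i]; rewrite ?f2 ?f1 ?g2 ?g1.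
- move=> e p s ev s2 /=; rewrite geq_max => /andP[eb pb] h; exists s2; split=> //.
  by apply: ExecWhileFalse; rewrite -(eval_agree _ h).
Qed.

Definition small X s :=
  (forall r, reg s r <= X) /\ (forall a i, arr s a i <= X).

Lemma small_set_reg X s r v : small X s -> v <= X -> small X (set_reg s r v).
Proof. by case=> hr ha vX; split=> //= r'; case: ifP. Qed.

Lemma small_set_arr X s a i v : small X s -> v <= X -> small X (set_arr s a i v).
Proof. by case=> hr ha vX; split=> //= a' j; case: ifP. Qed.

Lemma small_leq X Y s : X <= Y -> small X s -> small Y s.
Proof. by move=> XY [hr ha]; split=> *; apply: leq_trans XY. Qed.

(** Every value written has passed the check in [eval]. So even the cells filled by an unknown
    program are bounded afterwards. *)
Lemma exec_small B X p s k s' : B <= X -> exec B p s k s' -> small X s -> small X s'.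
Proof.
move=> BX; elim=> {p s k s'} //.
- by move=> x e s v /eval_leq vB h; apply: small_set_reg => //; apply: leq_trans BX.
- by move=> a e1 e2 s i v _ /eval_leq vB h; apply: small_set_arr => //; apply: leq_trans BX.
- by move=> p q s k s' l s'' _ IHp _ IHq /IHp/IHq.
- by move=> e p s v k s' l s'' _ _ _ IHp _ IHq /IHp/IHq.
Qed.

Fixpoint evaln (s : state) (e : expr) : nat :=
  match e with
  | Const k => k
  | Reg x => reg s x
  | Get a e => arr s a (evaln s e)
  | Op o e1 e2 => binop_sem o (evaln s e1) (evaln s e2)
  end.

(** [Const k] gets degree [k] because [k <= M ^ k] when [1 < M]. *)
Fixpoint degree (D : nat) (e : expr) : nat :=
  match e with
  | Const k => k
  | Reg _ => D
  | Get _ e => maxn D (degree D e)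
  | Op Mul e1 e2 => degree D e1 + degree D e2
  | Op _ e1 e2 => (maxn (degree D e1) (degree D e2)).+1
  end.

(** Separates arithmetic from overflow: once the degree is at most [c], the unchecked value [evaln]
    is the value computed. The gap between [D] and [c] is the room for intermediate results. *)
Lemma eval_evaln M D c s e : 1 < M -> small (M ^ D) s -> degree D e <= c ->
  eval (M ^ c) s e = Some (evaln s e) /\ evaln s e <= M ^ degree D e.
Proof.
move=> M1 [hr ha].
have lem x k l : x <= M ^ k -> k <= l -> x <= M ^ l.
  by move=> h kl; apply: leq_trans h _; rewrite leq_exp2l.
elim: e => [k|x|a e IHe|o e1 IH1 e2 IH2] /=.
- move=> kc; have h : k <= M ^ k by rewrite ltnW // ltn_expl.
  by rewrite fits_id //; apply: lem h kc.
- by move=> Dc; rewrite fits_id //; apply: lem (hr _) Dc.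
- rewrite geq_max => /andP[Dc /IHe[-> h]]; rewrite fits_id; last exact: lem (ha _ _) _.
  by split=> //; apply: (lem _ _ _ (ha _ _)); rewrite leq_max leqnn.
- suff H : degree D (Op o e1 e2) <= c -> [/\ degree D e1 <= c, degree D e2 <= c
    & (evaln s e1 <= M ^ degree D e1 -> evaln s e2 <= M ^ degree D e2 ->
       binop_sem o (evaln s e1) (evaln s e2) <= M ^ degree D (Op o e1 e2))].
    move=> dc; have [d1 d2 h] := H dc; have [-> h1] := IH1 d1; have [-> h2] := IH2 d2.
    by have {}h := h h1 h2; rewrite fits_id //; apply: lem h dc.
  have M0 j : 0 < M ^ j by rewrite expn_gt0 (ltn_trans _ M1).
  have P k l x y : x <= M ^ k -> y <= M ^ l -> x + y <= M ^ (maxn k l).+1.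
    move=> hx hy; have hx' : x <= M ^ maxn k l by apply: lem hx _; rewrite leq_maxl.
    have hy' : y <= M ^ maxn k l by apply: lem hy _; rewrite leq_maxr.
    by rewrite expnS; nia.
  have Q k l x : x <= M ^ k -> x <= M ^ (maxn k l).+1.
    by move=> h; apply: lem h _; rewrite leqW // leq_maxl.
  case: o => /= dc; split; try (by clear -dc; lia); clear dc; move=> hx hy.
  + exact: P.
  + by apply: leq_trans (Q _ _ _ hx); rewrite leq_subr.
  + by rewrite expnD leq_mul.
  + by apply: leq_trans (Q _ _ _ hx); rewrite leq_div.
  + by apply: leq_trans (Q _ _ _ hx); rewrite leq_mod.
  + by apply: leq_trans (M0 _); case: eqP.
  + by apply: leq_trans (M0 _); case: ltnP.
Qed.

Definition ok B p s k (Q : state -> Prop) :=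
  exists t s', [/\ exec B p s t s', t <= k & Q s'].

Lemma ok_weaken B p s k k' (Q Q' : state -> Prop) :
  ok B p s k Q -> k <= k' -> (forall s', Q s' -> Q' s') -> ok B p s k' Q'.
Proof.
move=> [t [s' [e h q]]] kk' QQ'; exists t, s'; split=> //; last exact: QQ'.
exact: leq_trans kk'.
Qed.

Lemma ok_seq B p q s k l Q :
  ok B p s k (fun s' => ok B q s' l Q) -> ok B (Seq p q) s (k + l) Q.
Proof.
case=> t [s' [e h [t' [s'' [e' h' q']]]]]; exists (t + t'), s''; split=> //.
  by econstructor; eassumption.
exact: leq_add.
Qed.

Lemma ok_while B T (xs : seq T) (I : seq T -> state -> Prop) (c : T -> nat) e p s :
  (forall l1 x l2 s', xs = l1 ++ x :: l2 -> I l1 s' ->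
     (exists2 v, eval B s' e = Some v & v != 0) /\ ok B p s' (c x) (I (rcons l1 x))) ->
  (forall s', I xs s' -> eval B s' e = Some 0) ->
  I [::] s ->
  ok B (While e p) s (\sum_(x <- xs) (c x + (ecost e).+1) + (ecost e).+1) (I xs).
Proof.
move=> Hstep Hend H0.
suff: forall l2 l1 s', xs = l1 ++ l2 -> I l1 s' ->
    ok B (While e p) s' (\sum_(x <- l2) (c x + (ecost e).+1) + (ecost e).+1) (I xs).
  by move=> /(_ xs [::] s erefl H0).
elim=> [|x l2 IH] l1 s'.
  rewrite cats0 => <- H; rewrite big_nil; exists (ecost e).+1, s'; split=> //.
  by constructor; exact: Hend.
move=> Exs H; have [[v ev v0] [t [u [eu tu Iu]]]] := Hstep _ _ _ _ Exs H.
have [|t' [u' [eu' tu' Iu']]] := IH (rcons l1 x) u _ Iu; first by rewrite cat_rcons.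
exists (ecost e + t + t').+1, u'; split=> //.
  by apply: ExecWhileTrue v0 eu eu'.
by rewrite big_cons; lia.
Qed.

(** For loop-free code this bound does not depend on the state, hence not on the graph. The value at
    a loop is a placeholder, as [wp] rejects loops. *)
Fixpoint max_cost (p : prog) : nat :=
  match p with
  | Skip => 1
  | Assign _ e => (ecost e).+1
  | Store _ e1 e2 => (ecost e1 + ecost e2).+1
  | Seq p q => max_cost p + max_cost q
  | If e p q => (ecost e + maxn (max_cost p) (max_cost q)).+1
  | While _ _ => 0
  end.

Fixpoint prog_degree (D : nat) (p : prog) : nat :=
  match p with
  | Skip => 0
  | Assign _ e => degree D e
  | Store _ e1 e2 => maxn (degree D e1) (degree D e2)
  | Seq p q => maxn (prog_degree D p) (prog_degree D q)
  | If e p q => maxn (degree D e) (maxn (prog_degree D p) (prog_degree D q))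
  | While e p => maxn (degree D e) (prog_degree D p)
  end.

(** For loop-free programs only; [ok_while] deals with loops. *)
Fixpoint wp (X : nat) (p : prog) (s : state) (Q : state -> Prop) : Prop :=
  match p with
  | Skip => Q s
  | Assign x e => evaln s e <= X /\ Q (set_reg s x (evaln s e))
  | Store a e1 e2 =>
      evaln s e2 <= X /\ Q (set_arr s a (evaln s e1) (evaln s e2))
  | Seq p q => wp X p s (fun s' => wp X q s' Q)
  | If e p q => if evaln s e != 0 then wp X p s Q else wp X q s Q
  | While _ _ => False
  end.

(** [wp] asks only that stored values be at most [M ^ D]; what happens inside expressions is covered
    by the static condition on [prog_degree]. Smallness is handed on to the next piece of code. *)
Lemma ok_wp M D c p s Q : 1 < M -> small (M ^ D) s -> prog_degree D p <= c ->
  wp (M ^ D) p s Q ->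
  ok (M ^ c) p s (max_cost p) (fun s' => small (M ^ D) s' /\ Q s').
Proof.
move=> M1; elim: p s Q => [|x e|a e1 e2|p IHp q IHq|e p IHp q IHq|//] s Q sm /=.
- by move=> _ h; exists 1, s; split=> //; constructor.
- move=> dc [vX q]; exists (ecost e).+1, (set_reg s x (evaln s e)); split=> //.
    by constructor; have [] := eval_evaln M1 sm dc.
  by split=> //; apply: small_set_reg.
- rewrite geq_max => /andP[d1 d2] [vX q].
  exists (ecost e1 + ecost e2).+1, (set_arr s a (evaln s e1) (evaln s e2)).
  split=> //; last by split=> //; apply: small_set_arr.
  by constructor; [have [] := eval_evaln M1 sm d1 | have [] := eval_evaln M1 sm d2].
- rewrite geq_max => /andP[d1 d2] h; apply: ok_seq.
  by apply: ok_weaken (IHp _ _ sm d1 h) _ _ => // s' [sm' h']; apply: IHq.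
- rewrite !geq_max => /and3P[d dp dq].
  have [ev _] := eval_evaln M1 sm d.
  case: ifP => v0 h.
    have [t [s' [ex tk h']]] := IHp _ _ sm dp h.
    exists (ecost e + t).+1, s'; split=> //; first exact: ExecIfTrue ev v0 ex.
    by rewrite ltnS leq_add2l leq_max tk.
  have [t [s' [ex tk h']]] := IHq _ _ sm dq h.
  exists (ecost e + t).+1, s'; split=> //; last by rewrite ltnS leq_add2l leq_max tk orbT.
  by apply: ExecIfFalse ex; rewrite ev; move/negbFE/eqP: v0 => ->.
Qed.

Lemma wp_weaken X p s (Q Q' : state -> Prop) : (forall s', Q s' -> Q' s') ->
  wp X p s Q -> wp X p s Q'.
Proof.
elim: p s Q Q' => //= [s Q Q' h| x e s Q Q' h|a e1 e2 s Q Q' h|p IHp q IHq s Q Q' h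
    |e p IHp q IHq s Q Q' h].
- exact: h.
- by case=> ? /h.
- by case=> ? /h.
- by apply: IHp => s'; apply: IHq.
- by case: ifP => _; [apply: IHp | apply: IHq].
Qed.

(** * Charging the edges of a forest *)

Lemma adj_sym n (E : {set {set 'I_n}}) : symmetric (adj E).
Proof. by move=> x y; rewrite /adj /= setUC. Qed.

Lemma adj_irr n (G : sgraph n) x : adj (edges G) x x = false.
Proof.
apply/negP; rewrite /adj /= => h; have /forallP/(_ [set x; x]) := edges_card2 G.
by rewrite h /= setUid cards1.
Qed.

Lemma is_forest_sub n (E F : {set {set 'I_n}}) : F \subset E -> is_forest E -> is_forest F.
Proof.
move=> /subsetP FE /forallP fE; apply/forallP => k; apply/forallP => p; apply/implyP => k2.
move/(_ k)/forallP/(_ p): fE; rewrite k2 /=; apply: contra.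
rewrite /ucycleb => /andP[c ->]; rewrite andbT; case: (tval p) c => //= x s.
by apply: sub_path => a b; apply: FE.
Qed.

Lemma forest_acyclic n (E : {set {set 'I_n}}) p :
  is_forest E -> 2 < size p -> ucycleb (adj E) p -> False.
Proof.
move=> /forallP fE p2 c; have pn : size p < n.+1.
  have /andP[_ /card_uniqP <-] := c; rewrite ltnS -[X in _ <= X]card_ord; exact: max_card.
by move/(_ (Ordinal pn))/forallP/(_ (in_tuple p)): fE; rewrite /= p2 c.
Qed.

(** Extend a path backwards from its first vertex. If that vertex is no leaf, a second edge leads to
    a vertex [z]: either [z] is on the path and closes a cycle, or the path grows, which cannot go
    on beyond [n] vertices. *)
Lemma forest_leaf n (E : {set {set 'I_n}}) :
  is_forest E -> (forall e, e \in E -> #|e| = 2) -> E != set0 ->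
  exists x e, [/\ e \in E, x \in e & forall f, f \in E -> x \in f -> f = e].
Proof.
move=> fE E2 /set0Pn[e0 e0E].
have pair e x : e \in E -> x \in e -> exists2 y, x != y & e = [set x; y].
  move=> eE xe; have /eqP/cards2P[a [b [ab Ee]]] := E2 _ eE.
  move: xe; rewrite Ee !inE => /orP[]/eqP->; first by exists b.
  by exists a; [rewrite eq_sym | rewrite setUC].
(* The path has at least [k + 2] vertices, so [k = n] is impossible. *)
suff H k : (exists x e, [/\ e \in E, x \in e & forall f, f \in E -> x \in f -> f = e]) \/
    exists x y p, [/\ path (adj E) x (y :: p), uniq (x :: y :: p) & size p >= k].
  case: (H n) => // -[x [y [p [_ u sp]]]].
  have : size (x :: y :: p) <= n.
    by move/card_uniqP: (u) => <-; rewrite -[X in _ <= X]card_ord; exact: max_card.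
  by move=> /=; lia.
elim: k => [|k [IH|[x [y [p [pp u sp]]]]]]; [|by left|].
  right; have /eqP/cards2P[a [b [ab Ee]]] := E2 _ e0E.
  by exists a, b, [::]; rewrite /= !inE ab /adj /= -Ee e0E.
have xyE : [set x; y] \in E by case/andP: pp.
have [h|] := boolP [forall f in E, (x \in f) ==> (f == [set x; y])].
  left; exists x, [set x; y]; split=> //; first by rewrite !inE eqxx.
  by move=> f fE' xf; move/forall_inP/(_ f fE')/implyP/(_ xf)/eqP: h.
rewrite negb_forall_in => /exists_inP[f fE']; rewrite negb_imply => /andP[xf nf].
have [z xz Ef] := pair _ _ fE' xf.
have zy : z != y by apply: contraNneq nf => <-; rewrite Ef.
have axz : adj E x z by rewrite /adj /= -Ef.
(* The part of the path from [x] to [z], closed by the edge [xz], has at least three vertices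
   because [z] differs from [y]. *)
have [zp|zp] := boolP (z \in p).
  exfalso; case/splitPr: zp pp u => p1 p2 pp u.
  apply: (@forest_acyclic _ E (x :: y :: rcons p1 z) fE).
    by rewrite /= size_rcons.
  rewrite /ucycleb; apply/andP; split.
    rewrite /cycle rcons_path last_cons last_rcons adj_sym axz andbT.
    by move: pp; rewrite -cat_rcons -cat_cons cat_path => /andP[].
  by move: u; rewrite -cat_rcons -!cat_cons cat_uniq => /andP[].
right; exists z, x, (y :: p); split=> //.
  by apply/andP; split; first rewrite adj_sym.
by rewrite cons_uniq u andbT !inE !negb_or zy zp eq_sym xz.
Qed.

(** By induction: remove the only edge at a leaf and charge it to the leaf, which lies on no
    remaining edge. The charge is an [option] because ['I_n] may be empty. *)
Lemma forest_injective_endpoint n (E : {set {set 'I_n}}) :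
  is_forest E -> (forall e, e \in E -> #|e| = 2) ->
  exists2 ch : {set 'I_n} -> option 'I_n,
    forall e, e \in E -> exists2 x, ch e = Some x & x \in e
    & {in E &, injective ch}.
Proof.
have [k] := ubnP #|E|; elim: k E => // k IH E; rewrite ltnS => Ek fE E2.
have [->|E0] := eqVneq E set0.
  by exists (fun=> None) => [e|e f]; rewrite inE.
have [x [e [eE xe xu]]] := forest_leaf fE E2 E0.
have sub : E :\ e \subset E by rewrite subD1set.
have [|||ch chE chI] := IH (E :\ e).
- by rewrite (leq_trans _ Ek) // [X in _ < X](cardsD1 e) eE.
- exact: is_forest_sub fE.
- by move=> f /(subsetP sub)/E2.
exists (fun f => if f == e then Some x else ch f) => [f fE'|f g fE' gE].
  by case: eqP => [->|/eqP fe]; [exists x | apply: chE; rewrite !inE fe].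
case: eqP => [->|/eqP fe]; case: eqP => [->|/eqP ge] //.
- have [|y -> yg [xy]] := chE g; first by rewrite !inE ge.
  by rewrite (xu g) // xy.
- have [|y -> yf [xy]] := chE f; first by rewrite !inE fe.
  by rewrite (xu f) // -xy.
- by apply: chI; rewrite !inE ?fe ?ge.
Qed.

(** * Degrees of the lower endpoints of edges *)

Section Degrees.
Variables (n : nat) (G : sgraph n).
Let A := adj (edges G).

Definition deg (v : 'I_n) : nat := \sum_u A v u.

(** Vertices ordered by degree, ties broken by index. *)
Definition rank (v : 'I_n) : nat := deg v * n + v.

Lemma rank_inj : injective rank.
Proof.
move=> x y /(congr1 (modn^~ n)); rewrite !modnMDl !modn_small // => h; exact: val_inj.
Qed.

Lemma deg_rank u v : rank u < rank v -> deg u <= deg v.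
Proof. by rewrite /rank; have := ltn_ord u; have := ltn_ord v; nia. Qed.

Lemma edge_pairs (P : pred ('I_n * 'I_n)) (F : 'I_n * 'I_n -> nat) :
  \sum_(p | A p.1 p.2 && P p) F p =
  \sum_(e in edges G) \sum_(p | ([set p.1; p.2] == e) && P p) F p.
Proof.
rewrite (partition_big (fun p => [set p.1; p.2]) (mem (edges G))) /=; last first.
  by move=> p /andP[].
apply: eq_bigr => e eE; apply: eq_bigl => p; case: eqP => [Ee|]; rewrite ?andbF // andbT.
by rewrite /A /adj /= Ee eE.
Qed.

Lemma set2_eqP (p q : 'I_n * 'I_n) : [set p.1; p.2] = [set q.1; q.2] ->
  p = q \/ p = (q.2, q.1).
Proof.
case: p q => a b [c d] /= E.
have : a \in [set c; d] by rewrite -E !inE eqxx.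
have : b \in [set c; d] by rewrite -E !inE eqxx orbT.
have : c \in [set a; b] by rewrite E !inE eqxx.
have : d \in [set a; b] by rewrite E !inE eqxx orbT.
rewrite !inE => /orP[]/eqP-> /orP[]/eqP-> /orP[]/eqP h1 /orP[]/eqP h2; subst; by [left|right].
Qed.

Lemma sum_deg : \sum_v deg v <= 2 * #|edges G|.
Proof.
rewrite pair_big /=.
have -> : \sum_p (A p.1 p.2 : nat) = \sum_(p | A p.1 p.2 && predT p) 1.
  by rewrite [RHS]big_mkcond; apply: eq_bigr => p _ /=; case: A.
rewrite edge_pairs mulnC -sum_nat_const leq_sum // => e eE.
case: (pickP (fun p : 'I_n * 'I_n => [set p.1; p.2] == e)) => [p /eqP pe|none]; last first.
  by rewrite big_pred0 // => p; rewrite none.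
rewrite sum1_card (@leq_trans #|[set p; (p.2, p.1)]|) //; last by rewrite cards2; case: eqP.
apply/subset_leq_card/subsetP => q /andP[/eqP]; rewrite -pe => /set2_eqP[]-> _.
  by rewrite !inE eqxx.
by rewrite !inE eqxx orbT.
Qed.

(** Absorbs costs linear in the number of edges into [arboricity G * #|edges G|]. *)
Lemma arboricity_gt0 : 0 < #|edges G| -> 0 < arboricity G.
Proof.
rewrite /arboricity; case: ex_minnP => -[|k] // /existsP[F /and3P[_ _ /eqP h]] _.
by rewrite -h big_ord0 cards0.
Qed.

(** Within one forest, the lower endpoint of an edge has at most the degree of the endpoint charged
    for it. The charges being distinct, each forest contributes at most the sum of all degrees. *)
Lemma sum_deg_below :
  \sum_v \sum_(u | A v u && (rank u < rank v)) deg u <= arboricity G * (2 * #|edges G|).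
Proof.
rewrite pair_big_dep /=.
rewrite (eq_bigl (fun p => A p.1 p.2 && (rank p.2 < rank p.1))) // edge_pairs.
rewrite /arboricity; case: ex_minnP => k /existsP[F /and3P[/forallP fF _ /eqP FE]] _.
pose g (e : {set 'I_n}) :=
  \sum_(p : 'I_n * 'I_n | ([set p.1; p.2] == e) && (rank p.2 < rank p.1)) deg p.2.
rewrite -/(\sum_(e in edges G) g e).
apply: (@leq_trans (\sum_i \sum_(e in F i) g e)).
  rewrite (exchange_big_dep (mem (edges G))) /=; last first.
    by move=> i e _ ei; rewrite -FE; apply/bigcupP; exists i.
  rewrite leq_sum // => e; rewrite -FE => /bigcupP[i _ ei].
  by rewrite (bigD1 i) //= leq_addr.
apply: (@leq_trans (\sum_(i < k) 2 * #|edges G|)); last by rewrite sum_nat_const card_ord.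
rewrite leq_sum // => i _; apply: leq_trans sum_deg.
have E2 e : e \in F i -> #|e| = 2.
  move=> eF; have eE : e \in edges G by rewrite -FE; apply/bigcupP; exists i.
  by have /forallP/(_ e) := edges_card2 G; rewrite eE => /eqP.
have [ch chE chI] := forest_injective_endpoint (fF i) E2.
pose dd (o : option 'I_n) := if o is Some x then deg x else 0.
apply: (@leq_trans (\sum_(e in F i) dd (ch e))).
  rewrite leq_sum // => e eF; have [x -> xe] := chE e eF; rewrite /g /=.
  case: (pickP (fun p : 'I_n * 'I_n => ([set p.1; p.2] == e) && (rank p.2 < rank p.1)))
      => [p /andP[/eqP pe pr]|none]; last by rewrite big_pred0.
  rewrite (big_pred1 p) => [|q].
    by move: xe; rewrite -pe !inE => /orP[]/eqP-> //; exact: deg_rank.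
  apply/andP/eqP => [[/eqP]|-> //]; last by rewrite pe.
  by rewrite -pe => /set2_eqP[]-> //= /(ltn_trans pr); rewrite ltnn.
rewrite -(big_imset (h := ch) dd) //=.
apply: (@leq_trans (\sum_o dd o)).
  by rewrite big_mkcond leq_sum // => o _; case: ifP.
rewrite (bigD1 None) //= add0n.
rewrite (reindex_omap Some id) /=; last by case.
by rewrite big_mkcond leq_sum // => v _; case: ifP.
Qed.

End Degrees.

(** * Loops over vertices and neighbours *)

Fixpoint writes (r : nat) (p : prog) : bool :=
  match p with
  | Assign x _ => r == x
  | Seq p q => writes r p || writes r q
  | If _ p q => writes r p || writes r q
  | While _ p => writes r p
  | _ => false
  end.

Lemma exec_writes B r p s k s' : exec B p s k s' -> ~~ writes r p -> reg s' r = reg s r.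
Proof.
elim=> {p s k s'} //=.
- by move=> x e s v _ /negPf ->.
- by move=> p q s k s' l s'' _ IHp _ IHq; rewrite negb_or => /andP[/IHp<- /IHq->].
- by move=> e p q s v k s' _ _ _ IHp; rewrite negb_or => /andP[/IHp<-].
- by move=> e p q s k s' _ _ IHp; rewrite negb_or => /andP[_ /IHp<-].
- by move=> e p s v k s' l s'' _ _ _ IHp _ IHw h; rewrite IHw ?IHp.
Qed.

Lemma ok_writes B r p s k Q : ~~ writes r p -> ok B p s k Q ->
  ok B p s k (fun s' => Q s' /\ reg s' r = reg s r).
Proof.
move=> w [t [s' [ex tk q]]]; exists t, s'; split=> //; split=> //.
exact: exec_writes ex w.
Qed.

Section Input.
Variables (n : nat) (G : sgraph n) (nb : 'I_n -> seq 'I_n).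
Hypothesis nbG : adjacency_lists G nb.
Let A := adj (edges G).

Definition offset (v : nat) : nat := \sum_(u < n | u < v) size (nb u).

Lemma offsetS (v : 'I_n) : offset v.+1 = offset v + size (nb v).
Proof.
rewrite /offset (bigD1 v) //= addnC; congr (_ + _).
by apply: eq_bigl => u; rewrite ltnS ltn_neqAle -val_eqE andbC.
Qed.

(** This is the form in which [flatten_index] locates an entry of a concatenation. *)
Lemma offset_take v : v <= n ->
  offset v = sumn (take v (shape [seq nb u | u <- enum 'I_n])).
Proof.
elim: v => [|v IH] vn; first by rewrite take0 /offset big_pred0.
have sz : size (shape [seq nb u | u <- enum 'I_n]) = n.
    by rewrite /shape 2!size_map size_enum_ord.
rewrite (offsetS (Ordinal vn)) /= IH 1?ltnW // (take_nth 0) ?sz // sumn_rcons.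
congr (_ + _); rewrite /shape -map_comp (nth_map (Ordinal vn)) ?size_enum_ord //=.
by congr (size (nb _)); apply: val_inj; rewrite /= nth_enum_ord.
Qed.

Lemma input_offset v : v <= n -> arr (input_state nb) 0 v = offset v.
Proof. by move=> vn /=; rewrite nth_mkseq. Qed.

Lemma input_neighbour (v : 'I_n) us u us' : nb v = us ++ u :: us' ->
  arr (input_state nb) 1 (offset v + size us) = u.
Proof.
move=> E /=; set ss := [seq nb u | u <- enum 'I_n].
have ssv : nth [::] ss v = nb v.
  rewrite (nth_map v) ?size_enum_ord //; congr nb; apply: val_inj.
  by rewrite /= nth_enum_ord.
have lt : size us < nth 0 (shape ss) v.
  have vs : v < size ss by rewrite size_map size_enum_ord.
  by rewrite /shape (nth_map [::]) // ssv E size_cat /=; lia.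
have fi : offset v + size us = flatten_index (shape ss) v (size us).
  by rewrite offset_take 1?ltnW.
have lt' : offset v + size us < size (flatten ss).
  by rewrite size_flatten fi; exact: flatten_indexP.
rewrite (nth_map u) // nth_flatten fi flatten_indexKl // flatten_indexKr //.
rewrite (_ : nth [::] ss v = us ++ u :: us') ?ssv //.
by rewrite nth_cat ltnn subnn.
Qed.

Lemma size_nb v : size (nb v) = deg G v.
Proof.
have [/card_uniqP <- nbE] := nbG v; rewrite /deg -sum1_card big_mkcond.
by apply: eq_bigr => u _; rewrite nbE inE; case: adj.
Qed.

Definition same_input (s : state) :=
  reg s 0 = n /\ forall a i, a < 2 -> arr s a i = arr (input_state nb) a i.

Section Program.
(** [R] names registers and arrays that the input does not use. *)
Variable R : nat -> nat.
Hypothesis RE : forall i j, (R i == R j) = (i == j).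
Hypothesis R_ge2 : forall i, 2 <= R i.

Lemma R_neq0 i : (0 == R i) = false. Proof. by have := R_ge2 i; lia. Qed.
Lemma R_neq1 i : (1 == R i) = false. Proof. by have := R_ge2 i; lia. Qed.

Lemma same_input_reg s i v : same_input s -> same_input (set_reg s (R i) v).
Proof. by case=> h0 ha; split=> //=; rewrite R_neq0. Qed.

Lemma same_input_arr s i j v : same_input s -> same_input (set_arr s (R i) j v).
Proof.
case=> h0 ha; split=> //= a k a2; case: eqP => [E|_]; last exact: ha.
by have := R_ge2 i; lia.
Qed.

Definition for_vertices (V : nat) (body : prog) : prog :=
  Seq (Assign V (Const 0))
    (While (Op Lt (Reg V) (Reg 0))
       (Seq body (Assign V (Op Add (Reg V) (Const 1))))).

Definition for_neighbours (x i h u : nat) (body : prog) : prog :=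
  Seq (Assign i (Get 0 (Reg x)))
    (Seq (Assign h (Get 0 (Op Add (Reg x) (Const 1))))
       (While (Op Lt (Reg i) (Reg h))
          (Seq (Assign u (Get 1 (Reg i)))
             (Seq body (Assign i (Op Add (Reg i) (Const 1))))))).

Variables (M D c : nat).
Hypotheses (M1 : 1 < M) (Dc : D + 5 <= c) (nM : n <= M ^ D).
Let ok' := ok (M ^ c).
Let X := M ^ D.

(** The invariant has to survive writes to the loop register, since the loop changes it between two
    runs of the body; the body itself must leave it alone. *)
Lemma ok_for_vertices V body (I : seq 'I_n -> state -> Prop) (k : 'I_n -> nat) s :
  (forall vs s, I vs s -> same_input s) ->
  (forall vs s x, I vs s -> I vs (set_reg s (R V) x)) ->
  ~~ writes (R V) body ->
  (forall vs v vs' s, enum 'I_n = vs ++ v :: vs' -> I vs s -> small X s ->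
     reg s (R V) = v ->
     ok' body s (k v) (fun s' => small X s' /\ I (rcons vs v) s')) ->
  small X s -> I [::] s ->
  ok' (for_vertices (R V) body) s (\sum_v (k v + 8) + 6)
    (fun s' => small X s' /\ I (enum 'I_n) s').
Proof.
move=> Iin Ist wr Hb sm I0.
pose J vs s := [/\ small X s, I vs s & reg s (R V) = size vs].
have en vs v vs' : enum 'I_n = vs ++ v :: vs' -> v = size vs :> nat.
  move=> E; have vn : size vs < n.
    by rewrite -[X in _ < X](size_enum_ord n) E size_cat /=; lia.
  have := nth_enum_ord v vn; rewrite E nth_cat ltnn subnn /= => ->.
  by [].
(* Initialisation costs 2, each increment 4 and each test 4, the last test included. *)
apply: (@ok_weaken _ _ _ (2 + (\sum_(v <- enum 'I_n) (k v + 4 + 4) + 4)) _ (J (enum 'I_n))).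
- apply: ok_seq.
  have /(ok_wp (c := c) M1 sm) H : wp X (Assign (R V) (Const 0)) s (J [::]).
    split; first by rewrite /=.
    by split; [apply: small_set_reg | apply: Ist | rewrite /= eqxx].
  apply: ok_weaken (H _) _ _ => // s1 [_ J0].
  apply: (@ok_while _ _ _ J) J0 => [vs v vs' s2 E [sm2 I2 V2]|s2 [sm2 I2 V2]].
    have V2' : reg s2 (R V) = v by rewrite V2 (en _ _ _ E).
    split.
      exists 1 => //; have [|-> _] := @eval_evaln M D c s2 (Op Lt (Reg (R V)) (Reg 0)) M1 sm2.
        by rewrite /=; lia.
      by rewrite /= V2' (Iin _ _ I2).1 ltn_ord.
    apply: ok_seq; apply: ok_weaken (ok_writes wr (Hb _ _ _ _ E I2 sm2 V2')) _ _ => //.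
    move=> s3 [[sm3 I3] V3].
    have /(ok_wp (c := c) M1 sm3) H3 :
        wp X (Assign (R V) (Op Add (Reg (R V)) (Const 1))) s3 (J (rcons vs v)).
      have le : v + 1 <= X by apply: leq_trans nM; rewrite addn1.
      split; first by rewrite /= V3 V2'.
      split; [|exact: Ist|]; first by apply: small_set_reg => //=; rewrite V3 V2'.
      by rewrite /= eqxx V3 V2 size_rcons addn1.
    by apply: ok_weaken (H3 _) _ _ => [||s' [_ ?]] //=; lia.
  have [|-> _] := @eval_evaln M D c s2 (Op Lt (Reg (R V)) (Reg 0)) M1 sm2.
    by rewrite /=; lia.
  by rewrite /= V2 (Iin _ _ I2).1 size_enum_ord ltnn.
- rewrite big_enum /= addnC -addnA leq_add2r //.
  by apply/eq_leq/eq_bigr => v _; rewrite -addnA.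
- by move=> s' [].
Qed.

Lemma ok_for_neighbours x i h u body (v : 'I_n) (I : seq 'I_n -> state -> Prop)
    (k : 'I_n -> nat) s :
  (forall us s, I us s -> same_input s) ->
  (forall us s j y, j \in [:: i; h; u] -> I us s -> I us (set_reg s (R j) y)) ->
  uniq [:: x; i; h; u] ->
  ~~ writes (R i) body -> ~~ writes (R h) body ->
  (forall us w us' s, nb v = us ++ w :: us' -> I us s -> small X s ->
     reg s (R u) = w ->
     ok' body s (k w) (fun s' => small X s' /\ I (rcons us w) s')) ->
  small X s -> I [::] s -> reg s (R x) = v ->
  ok' (for_neighbours (R x) (R i) (R h) (R u) body) s
    (\sum_(w <- nb v) (k w + 11) + 12)
    (fun s' => small X s' /\ I (nb v) s').
Proof.
move=> Iin Ist; rewrite /= !inE !negb_or => /and4P[/and3P[xi xh xu] /andP[ih iu] hu _].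
move=> wi wh Hb sm I0 sx.
have Xoff y : arr s 0 y <= X by case: sm.
have IinJ s' us : I us s' -> forall a y, a < 2 -> arr s' a y = arr s a y.
  by move=> I1 a y a2; rewrite (Iin _ _ I1).2 // (Iin _ _ I0).2.
have off0 : arr s 0 v = offset v by rewrite (Iin _ _ I0).2 // input_offset 1?ltnW.
have off1 : arr s 0 (v + 1) = offset v + size (nb v).
  by rewrite (Iin _ _ I0).2 // input_offset addn1 // offsetS.
pose J us s' := [/\ small X s', I us s', reg s' (R i) = offset v + size us
   & reg s' (R h) = offset v + size (nb v)].
(* Reading the two offsets costs 3 and 5; each round costs 3 to fetch the neighbour, 4 to increment
   and 4 to test. *)
apply: (@ok_weaken _ _ _ (3 + (5 + (\sum_(w <- nb v) (3 + (k w + 4) + 4) + 4))) _ (J (nb v))).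
- apply: ok_seq; have /(ok_wp (c := c) M1 sm) H : wp X (Assign (R i) (Get 0 (Reg (R x)))) s
     (fun s1 => I [::] s1 /\ reg s1 (R i) = offset v /\ reg s1 (R x) = v).
    split; first by rewrite /= Xoff.
    by split; [by apply: Ist => //; rewrite !inE eqxx ?orbT | rewrite /= eqxx sx RE (negPf xi) off0].
  apply: ok_weaken (H _) _ _ => [||s1 [sm1 [I1 [i1 x1]]]] //=; first by lia.
  apply: ok_seq.
  have /(ok_wp (c := c) M1 sm1) H1 :
      wp X (Assign (R h) (Get 0 (Op Add (Reg (R x)) (Const 1)))) s1 (J [::]).
    split; first by rewrite /= (IinJ _ _ I1).
    split; first by apply: small_set_reg; rewrite //= (IinJ _ _ I1).
    + by apply: Ist => //; rewrite !inE eqxx ?orbT.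
    + by rewrite /= RE (negPf ih) i1 addn0.
    + by rewrite /= eqxx x1 (IinJ _ _ I1) // off1.
  apply: ok_weaken (H1 _) _ _ => [||s2 [_ J2]] //=; first by lia.
  apply: (@ok_while _ _ _ J) J2 => [us w us' s3 E [sm3 I3 i3 h3]|s3 [sm3 I3 i3 h3]].
    have [|ev _] := @eval_evaln M D c s3 (Op Lt (Reg (R i)) (Reg (R h))) M1 sm3.
      by rewrite /=; lia.
    split; first by exists 1; rewrite // ev /= i3 h3 E size_cat /= ltn_add2l; case: ltnP => //; lia.
    apply: ok_seq.
    have /(ok_wp (c := c) M1 sm3) H3 : wp X (Assign (R u) (Get 1 (Reg (R i)))) s3
       (fun s4 => [/\ I us s4, reg s4 (R u) = w, reg s4 (R i) = offset v + size us
                  & reg s4 (R h) = offset v + size (nb v)]).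
      split; first by rewrite /=; case: sm3.
      split; first by apply: Ist => //; rewrite !inE eqxx ?orbT.
      + by rewrite /= eqxx (Iin _ _ I3).2 // i3 (input_neighbour E).
      + by rewrite /= RE (negPf iu).
      + by rewrite /= RE (negPf hu).
    apply: ok_weaken (H3 _) _ _ => [||s4 [sm4 [I4 u4 i4 h4]]] //=; first by lia.
    apply: ok_seq.
    apply: ok_weaken (ok_writes wh (ok_writes wi (Hb _ _ _ _ E I4 sm4 u4))) _ _ => //.
    move=> s5 [[[sm5 I5] i5] h5].
    have /(ok_wp (c := c) M1 sm5) H5 :
        wp X (Assign (R i) (Op Add (Reg (R i)) (Const 1))) s5 (J (rcons us w)).
      (* The incremented index is at most the end of the list, which is itself a stored value and
         hence small. *)
      have le : reg s5 (R i) + 1 <= X.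
        apply: (leq_trans _ (Xoff (v + 1))).
        by rewrite off1 i5 i4 E size_cat /=; lia.
      split; first by [].
      split; [exact: small_set_reg|by apply: Ist => //; rewrite !inE eqxx ?orbT| |].
        by rewrite /= eqxx i5 i4 size_rcons; lia.
      by rewrite /= RE eq_sym (negPf ih) h5 h4.
    by apply: ok_weaken (H5 _) _ _ => [||s' [_ ?]] //=; lia.
  have [|-> _] := @eval_evaln M D c s3 (Op Lt (Reg (R i)) (Reg (R h))) M1 sm3.
    by rewrite /=; lia.
  by rewrite /= i3 h3 ltnn.
- rewrite (eq_bigr (fun w => k w + 11)) => [|w _]; lia.
- by move=> s' [].
Qed.

End Program.
End Input.

(** * The counting program *)

Section Code.
Variable R : nat -> nat.

Definition deg_expr (x : nat) : expr :=
  Op Defs.Sub (Get 0 (Op Add (Reg x) (Const 1))) (Get 0 (Reg x)).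

Definition rank_expr (x : nat) : expr :=
  Op Add (Op Mul (deg_expr x) (Reg 0)) (Reg x).

Definition cell (x y : nat) : expr := Op Add (Op Mul (Reg x) (Reg 0)) (Reg y).

Definition incr (x : nat) (e : expr) : prog := Assign x (Op Add (Reg x) e).

Definition minus (e : expr) (k : nat) : expr := Op Defs.Sub e (Const k).

(** Arrays [R 0], [R 1] and [R 2] are [n * n] tables: the adjacency matrix,
    [codegree] and [wedges].  Arrays start out zero, so that a table costs
    nothing to set up. *)
Definition fill_code : prog :=
  for_vertices (R 0) (for_neighbours (R 0) (R 1) (R 2) (R 3)
    (Store (R 0) (cell (R 0) (R 3)) (Const 1))).

Definition vertex_code : prog :=
  let d := deg_expr (R 0) in
  Seq (incr (R 7) d)
    (Seq (incr (R 8) (Op Mul d (minus d 1)))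
       (incr (R 9) (Op Mul d (Op Mul (minus d 1) (minus d 2))))).

(** An edge is met only from its higher endpoint; the factor 2 stands for its two orientations. *)
Definition pair_code : prog :=
  incr (R 10) (Op Mul (Const 2)
    (Op Mul (minus (deg_expr (R 0)) 1) (minus (deg_expr (R 3)) 1))).

(** The entry [t] is the number of common neighbours of the current edge found so far. In [4 * t],
    one factor 2 is for the two orientations of the edge and [2 * t] is the growth of
    [t * (t - 1)]. *)
Definition triangle_code : prog :=
  let t := Get (R 1) (cell (R 0) (R 3)) in
  If (Get (R 0) (cell (R 0) (R 6)))
    (Seq (incr (R 11) (Const 2))
       (Seq (incr (R 12) (Op Mul (Const 2) (minus (deg_expr (R 6)) 2)))
          (Seq (incr (R 13) (Op Mul (Const 4) t))
             (Store (R 1) (cell (R 0) (R 3)) (Op Add t (Const 1))))))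
    Skip.

(** Here [t] counts the paths found so far between the same two ends. There is no factor for
    orientation, as the first vertex is by choice the highest. *)
Definition wedge_code : prog :=
  let t := Get (R 2) (cell (R 0) (R 6)) in
  If (Op Lt (rank_expr (R 6)) (rank_expr (R 0)))
    (Seq (incr (R 14) (Op Mul (Const 2) t))
       (Store (R 2) (cell (R 0) (R 6)) (Op Add t (Const 1))))
    Skip.

Definition count_code : prog :=
  for_vertices (R 0)
    (Seq vertex_code
       (for_neighbours (R 0) (R 1) (R 2) (R 3)
          (If (Op Lt (rank_expr (R 3)) (rank_expr (R 0)))
             (Seq pair_code
                (for_neighbours (R 3) (R 4) (R 5) (R 6)
                   (Seq triangle_code wedge_code)))
             Skip))).

End Code.

(** From [(t + 1) * t - t * (t - 1) = 2 * t]. It turns a sum over a whole table, too long to be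
    computed at the end, into a constant-time update. *)
Lemma sum_falling_update (T : finType) (f g : T -> nat) (q : T) (b : bool) :
  (forall p, g p = f p + ((q == p) && b)) ->
  \sum_p g p * (g p - 1) = \sum_p f p * (f p - 1) + (if b then 2 * f q else 0).
Proof.
case: b => E; last first.
  by rewrite addn0; apply: eq_bigr => p _; rewrite E andbF addn0.
rewrite (bigD1 q) //= [in RHS](bigD1 q) //= E eqxx /=.
rewrite [X in _ + X](eq_bigr (fun p => f p * (f p - 1))) => [|p pq]; last first.
  by rewrite E eq_sym (negPf pq) addn0.
nia.
Qed.

(** * Running totals as functions of the lists of items treated so far, and their polynomial
    bounds *)

Section Spec.
Variables (n : nat) (G : sgraph n).
Let A := adj (edges G).
Implicit Types (vs : seq 'I_n) (ps : seq ('I_n * 'I_n)) (ts : seq ('I_n * 'I_n * 'I_n)).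

Definition deg_sum vs := \sum_(v <- vs) deg G v.
Definition cherry_sum vs := \sum_(v <- vs) deg G v * (deg G v - 1).
Definition claw_sum vs := \sum_(v <- vs) deg G v * ((deg G v - 1) * (deg G v - 2)).
Definition path_sum ps := \sum_(p <- ps) 2 * ((deg G p.1 - 1) * (deg G p.2 - 1)).
Definition triangle_sum ts := \sum_(t <- ts) 2 * A t.1.1 t.2.
Definition paw_sum ts := \sum_(t <- ts) 2 * (A t.1.1 t.2 * (deg G t.2 - 2)).
Definition codegree ts p : nat := \sum_(t <- ts) ((t.1 == p) && A t.1.1 t.2).
Definition wedges ts p : nat :=
  \sum_(t <- ts) (((t.1.1, t.2) == p) && (rank G t.2 < rank G t.1.1)).
Definition diamond_sum ts := 2 * \sum_p codegree ts p * (codegree ts p - 1).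
Definition square_sum ts := \sum_p wedges ts p * (wedges ts p - 1).

(** Source of the polynomial bounds below, by which every running total fits in a word. *)
Lemma sum_seq_leq (T : Type) (s : seq T) (F : T -> nat) k :
  (forall x, F x <= k) -> \sum_(x <- s) F x <= size s * k.
Proof.
by move=> h; elim: s => [|x s IH]; rewrite ?big_nil // big_cons mulSn leq_add.
Qed.

Lemma deg_leq v : deg G v <= n.
Proof.
rewrite -[X in _ <= X](card_ord n) -sum1_card leq_sum // => u _; exact: leq_b1.
Qed.

Lemma deg_sum_leq vs : deg_sum vs <= size vs * n.
Proof. by apply: sum_seq_leq => v; exact: deg_leq. Qed.

Lemma cherry_sum_leq vs : cherry_sum vs <= size vs * n ^ 2.
Proof. by apply: sum_seq_leq => v; have := deg_leq v; nia. Qed.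

Lemma claw_sum_leq vs : claw_sum vs <= size vs * n ^ 3.
Proof.
apply: sum_seq_leq => v; rewrite expnS leq_mul ?deg_leq //.
by rewrite expnS expn1 leq_mul // (leq_trans (leq_subr _ _)) ?deg_leq.
Qed.

Lemma path_sum_leq ps : path_sum ps <= size ps * (2 * n ^ 2).
Proof.
apply: sum_seq_leq => p; rewrite leq_mul //.
by rewrite expnS expn1 leq_mul // (leq_trans (leq_subr _ _)) ?deg_leq.
Qed.

Lemma triangle_sum_leq ts : triangle_sum ts <= size ts * 2.
Proof. by apply: sum_seq_leq => t; case: A. Qed.

Lemma paw_sum_leq ts : paw_sum ts <= size ts * (2 * n).
Proof.
apply: sum_seq_leq => t; case: A; rewrite ?mul0n ?muln0 // mul1n leq_mul //.
exact: leq_trans (leq_subr _ _) (deg_leq _).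
Qed.

Lemma codegree_leq ts p : codegree ts p <= size ts.
Proof. by rewrite -[X in _ <= X]muln1; apply: sum_seq_leq => t; exact: leq_b1. Qed.

Lemma wedges_leq ts p : wedges ts p <= size ts.
Proof. by rewrite -[X in _ <= X]muln1; apply: sum_seq_leq => t; exact: leq_b1. Qed.

Lemma sum_falling_leq (f : 'I_n * 'I_n -> nat) k :
  (forall p, f p <= k) -> \sum_p f p * (f p - 1) <= n ^ 2 * k ^ 2.
Proof.
move=> h; apply: (@leq_trans (\sum_(p : 'I_n * 'I_n) k ^ 2)).
  by apply: leq_sum => p _; have := h p; nia.
by rewrite sum_nat_const card_prod card_ord leq_mul // expnS expn1.
Qed.

Lemma diamond_sum_leq ts : diamond_sum ts <= 2 * (n ^ 2 * size ts ^ 2).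
Proof. by rewrite leq_mul // sum_falling_leq // => p; exact: codegree_leq. Qed.

Lemma square_sum_leq ts : square_sum ts <= n ^ 2 * size ts ^ 2.
Proof. by rewrite sum_falling_leq // => p; exact: wedges_leq. Qed.

Lemma codegree_rcons ts t p :
  codegree (rcons ts t) p = codegree ts p + ((t.1 == p) && A t.1.1 t.2).
Proof. by rewrite /codegree -cats1 big_cat big_seq1. Qed.

Lemma wedges_rcons ts t p :
  wedges (rcons ts t) p =
  wedges ts p + (((t.1.1, t.2) == p) && (rank G t.2 < rank G t.1.1)).
Proof. by rewrite /wedges -cats1 big_cat big_seq1. Qed.

Lemma diamond_sum_rcons ts t : diamond_sum (rcons ts t) =
  diamond_sum ts + (if A t.1.1 t.2 then 4 * codegree ts t.1 else 0).
Proof.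
rewrite /diamond_sum (sum_falling_update (codegree_rcons ts t)).
by case: ifP => _; rewrite mulnDr ?mulnA.
Qed.

Lemma square_sum_rcons ts t : square_sum (rcons ts t) =
  square_sum ts + (if rank G t.2 < rank G t.1.1 then 2 * wedges ts (t.1.1, t.2) else 0).
Proof. exact: (sum_falling_update (wedges_rcons ts t)). Qed.

End Spec.

(** * The invariant of the counting loops and its preservation by the loop-free pieces *)

Section Invariant.
Variables (n : nat) (G : sgraph n) (nb : 'I_n -> seq 'I_n).
Hypothesis nbG : adjacency_lists G nb.
Let A := adj (edges G).
Variable R : nat -> nat.
Hypothesis RE : forall i j, (R i == R j) = (i == j).
Hypothesis R_ge2 : forall i, 2 <= R i.

(** [ts] and [us] list the paths already treated by [triangle_code] and by [wedge_code]. They are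
    kept apart because they differ between these two pieces of code. *)
Record invariant vs ps ts us (s : state) : Prop := Invariant {
  inv_input : same_input nb s;
  inv_adj : forall x y : 'I_n, arr s (R 0) (x * n + y) = A x y;
  inv_codegree : forall x y : 'I_n, arr s (R 1) (x * n + y) = codegree G ts (x, y);
  inv_wedges : forall x y : 'I_n, arr s (R 2) (x * n + y) = wedges G us (x, y);
  inv_deg : reg s (R 7) = deg_sum G vs;
  inv_cherry : reg s (R 8) = cherry_sum G vs;
  inv_claw : reg s (R 9) = claw_sum G vs;
  inv_path : reg s (R 10) = path_sum G ps;
  inv_triangle : reg s (R 11) = triangle_sum G ts;
  inv_paw : reg s (R 12) = paw_sum G ts;
  inv_diamond : reg s (R 13) = diamond_sum G ts;
  inv_square : reg s (R 14) = square_sum G us }.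

Lemma invariant_reg vs ps ts us s j x : j < 7 -> invariant vs ps ts us s ->
  invariant vs ps ts us (set_reg s (R j) x).
Proof.
move=> j7 [h0 h1 h2 h3 h4 h5 h6 h7 h8 h9 h10 h11].
have E k : 7 <= k -> (R k == R j) = false by rewrite RE; lia.
by split; rewrite //= ?E //; apply: same_input_reg.
Qed.

Lemma same_input_deg s (v : 'I_n) : same_input nb s ->
  arr s 0 (v + 1) - arr s 0 v = deg G v.
Proof.
case=> _ h; rewrite !h // addn1 !input_offset // 1?ltnW // offsetS.
by rewrite -(size_nb nbG) addKn.
Qed.

Lemma cell_eq (x y x' y' : 'I_n) : (x * n + y == x' * n + y') = ((x, y) == (x', y')).
Proof.
apply/eqP/eqP => [E|[-> ->//]]; have n0 : 0 < n by apply: leq_ltn_trans (ltn_ord x).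
have := congr1 (modn^~ n) E; have := congr1 (divn^~ n) E.
rewrite !modnMDl !divnMDl // !divn_small // !addn0 !modn_small // => e1 e2.
by congr (_, _); apply: val_inj.
Qed.

Variables (M D : nat).
Hypotheses (nM : n.+1 < M) (D12 : 12 <= D).
Let X := M ^ D.

Lemma poly_leq k x : x <= M ^ k -> k <= D -> x <= X.
Proof. by move=> h kD; apply: leq_trans h _; rewrite leq_exp2l //; lia. Qed.



(** The largest total is bounded by [2 * (n ^ 2 * size ts ^ 2)], of degree 1 + 2 + 6 = 9 in [M]; the
    requirement [12 <= D] leaves some slack. *)
Lemma triple_sums_small ts p : size ts <= M ^ 3 ->
  [/\ triangle_sum G ts <= X, paw_sum G ts <= X, diamond_sum G ts <= X,
      square_sum G ts <= X & codegree G ts p <= X /\ wedges G ts p <= X].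
Proof.
move=> sT; have n0 : n <= M by rewrite ltnW // ltnW.
have M2 : 2 <= M by apply: leq_trans nM.
have n2 : n ^ 2 <= M ^ 2 by rewrite leq_exp2r.
have s2 : size ts ^ 2 <= M ^ 6 by rewrite (expnM M 3 2) leq_exp2r.
have dle : 2 * (n ^ 2 * size ts ^ 2) <= M ^ 9.
  by rewrite (expnS M 8) leq_mul // (expnD M 2 6) leq_mul.
split.
- apply: (@poly_leq 4); last by apply: leq_trans D12.
  by apply: leq_trans (triangle_sum_leq _ _) _; rewrite mulnC expnS leq_mul.
- apply: (@poly_leq 5); last by apply: leq_trans D12.
  apply: leq_trans (paw_sum_leq _ _) _.
  by rewrite mulnC -mulnA (expnS M 4) leq_mul // (expnS M 3) leq_mul.
- apply: (@poly_leq 9); last by apply: leq_trans D12.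
  exact: leq_trans (diamond_sum_leq _ _) _.
- apply: (@poly_leq 9); last by apply: leq_trans D12.
  by apply: leq_trans (square_sum_leq _ _) _; apply: leq_trans dle; rewrite leq_pmull.
- split; apply: (@poly_leq 3); try by apply: leq_trans D12.
    exact: leq_trans (codegree_leq _ _ _) _.
  exact: leq_trans (wedges_leq _ _ _) _.
Qed.

Ltac simp := rewrite /= ?RE ?(R_neq0 R_ge2) ?(R_neq1 R_ge2) /=.

Lemma wp_triangle vs ps ts us (v u w : 'I_n) s :
  invariant vs ps ts us s -> size ts < M ^ 3 ->
  reg s (R 0) = v -> reg s (R 3) = u -> reg s (R 6) = w ->
  wp X (triangle_code R) s (invariant vs ps (rcons ts (v, u, w)) us).
Proof.
move=> I sT sv su sw.
have sT' : size (rcons ts (v, u, w)) <= M ^ 3 by rewrite size_rcons.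
have [hin h1 h2 h3 h4 h5 h6 h7 h8 h9 h10 h11] := I.
have h0 := hin.1.
have Etri : triangle_sum G (rcons ts (v, u, w)) = triangle_sum G ts + 2 * A v w.
  by rewrite /triangle_sum -cats1 big_cat big_seq1.
have Epaw : paw_sum G (rcons ts (v, u, w)) = paw_sum G ts + 2 * (A v w * (deg G w - 2)).
  by rewrite /paw_sum -cats1 big_cat big_seq1.
have Ediam := diamond_sum_rcons G ts (v, u, w).
have Ecod p := codegree_rcons G ts (v, u, w) p.
simp; rewrite sv sw h0 h1.
case Avw : (A v w) => /=; last first.
  rewrite /= -/A Avw in Ediam Etri Epaw; split=> //; rewrite ?Ediam ?Etri ?Epaw ?addn0 //.
  by move=> x y; rewrite Ecod /= -/A Avw andbF addn0.
have dw := same_input_deg w (inv_input I).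
(* The totals of the extended list are the very values about to be stored, so their bounds are the
   overflow conditions of [wp]. *)
have [b1 b2 b3 _ [b4 _]] := triple_sums_small (v, u) sT'.
rewrite /= -/A Avw ?mul1n in Ediam Etri Epaw.
rewrite Etri in b1; rewrite Epaw in b2; rewrite Ediam in b3.
rewrite Ecod eqxx /= -/A Avw in b4.
do 4 (simp; rewrite ?sv ?su ?sw ?h0 ?h2 ?h8 ?h9 ?h10 ?dw; split; first by []).
split; simp; rewrite ?Etri ?Epaw ?Ediam //.
- by do !first [exact: hin | apply: same_input_arr => // | apply: same_input_reg => //].
- move=> x y; rewrite cell_eq Ecod /= -/A Avw andbT eq_sym.
  by case: eqP => [<-|_]; rewrite ?h2 ?addn0.
Qed.

Lemma wp_wedge vs ps ts us (v u w : 'I_n) s :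
  invariant vs ps ts us s -> size us < M ^ 3 ->
  reg s (R 0) = v -> reg s (R 6) = w ->
  wp X (wedge_code R) s (invariant vs ps ts (rcons us (v, u, w))).
Proof.
move=> I sT sv sw.
have sT' : size (rcons us (v, u, w)) <= M ^ 3 by rewrite size_rcons.
have [hin h1 h2 h3 h4 h5 h6 h7 h8 h9 h10 h11] := I.
have h0 := hin.1.
have Esq := square_sum_rcons G us (v, u, w).
have Ew p := wedges_rcons G us (v, u, w) p.
have dw := same_input_deg w hin.
have dv := same_input_deg v hin.
simp; rewrite sv sw h0 dw dv -!/(rank G _).
case vw : (rank G w < rank G v) => /=; last first.
  rewrite /= vw in Esq; split=> //; rewrite ?Esq ?addn0 //.
  by move=> x y; rewrite Ew /= vw andbF addn0.
have [_ _ _ b1 [_ b2]] := triple_sums_small (v, w) sT'.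
rewrite /= vw in Esq; rewrite Esq in b1; rewrite Ew eqxx /= vw in b2.
do 2 (simp; rewrite ?sv ?sw ?h0 ?h3 ?h11; split; first by []).
split; simp; rewrite ?Esq //.
- by do !first [exact: hin | apply: same_input_arr => // | apply: same_input_reg => //].
- move=> x y; rewrite cell_eq Ew /= vw andbT eq_sym.
  by case: eqP => [<-|_]; rewrite ?h3 ?addn0.
Qed.

Lemma wp_pair vs ps ts us (v u : 'I_n) s :
  invariant vs ps ts us s -> size ps < M ^ 3 ->
  reg s (R 0) = v -> reg s (R 3) = u ->
  wp X (pair_code R) s (invariant vs (rcons ps (v, u)) ts us).
Proof.
move=> I sT sv su.
have [hin h1 h2 h3 h4 h5 h6 h7 h8 h9 h10 h11] := I.
have du := same_input_deg u hin.
have dv := same_input_deg v hin.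
have E : path_sum G (rcons ps (v, u)) =
    path_sum G ps + 2 * ((deg G v - 1) * (deg G u - 1)).
  by rewrite /path_sum -cats1 big_cat big_seq1.
have b : path_sum G (rcons ps (v, u)) <= X.
  apply: (@poly_leq 6); last by apply: leq_trans D12.
  apply: leq_trans (path_sum_leq _ _) _; rewrite size_rcons (expnD M 3 3) leq_mul //.
  by rewrite (expnS M 2) leq_mul ?leq_exp2r // ?(leq_trans _ nM) // ltnW // ltnW.
rewrite E in b.
do 1 (simp; rewrite sv su h7 dv du; split; first by []).
split; simp; rewrite ?E //.
by do !first [exact: hin | apply: same_input_arr => // | apply: same_input_reg => //].
Qed.

Lemma wp_vertex vs ps ts us (v : 'I_n) s :
  invariant vs ps ts us s -> size vs < n ->
  reg s (R 0) = v ->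
  wp X (vertex_code R) s (invariant (rcons vs v) ps ts us).
Proof.
move=> I sT sv.
have [hin h1 h2 h3 h4 h5 h6 h7 h8 h9 h10 h11] := I.
have dv := same_input_deg v hin.
have sr : size (rcons vs v) <= n by rewrite size_rcons.
have E1 : deg_sum G (rcons vs v) = deg_sum G vs + deg G v.
  by rewrite /deg_sum -cats1 big_cat big_seq1.
have E2 : cherry_sum G (rcons vs v) = cherry_sum G vs + deg G v * (deg G v - 1).
  by rewrite /cherry_sum -cats1 big_cat big_seq1.
have E3 : claw_sum G (rcons vs v) =
    claw_sum G vs + deg G v * ((deg G v - 1) * (deg G v - 2)).
  by rewrite /claw_sum -cats1 big_cat big_seq1.
have nM' : n <= M by rewrite ltnW // ltnW.
have b k x : x <= n ^ k.+1 -> k < 4 -> x <= X.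
  move=> h k4; apply: (@poly_leq k.+1); last by apply: leq_trans D12; lia.
  by apply: leq_trans h _; rewrite leq_exp2r.
have b1 : deg_sum G (rcons vs v) <= X.
  by apply: (b 1) => //; apply: leq_trans (deg_sum_leq _ _) _; rewrite expnS expn1 leq_mul.
have b2 : cherry_sum G (rcons vs v) <= X.
  by apply: (b 2) => //; apply: leq_trans (cherry_sum_leq _ _) _; rewrite expnS leq_mul.
have b3 : claw_sum G (rcons vs v) <= X.
  by apply: (b 3) => //; apply: leq_trans (claw_sum_leq _ _) _; rewrite expnS leq_mul.
rewrite E1 in b1; rewrite E2 in b2; rewrite E3 in b3.
do 3 (simp; rewrite ?sv ?h4 ?h5 ?h6 ?dv; split; first by []).
split; simp; rewrite ?E1 ?E2 ?E3 //.
by do !first [exact: hin | apply: same_input_arr => // | apply: same_input_reg => //].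
Qed.

End Invariant.

Lemma ok_if B e p q s v k l Q : eval B s e = Some v ->
  (v != 0 -> ok B p s k Q) -> (v == 0 -> ok B q s l Q) ->
  ok B (If e p q) s (ecost e + (if v == 0 then l else k)).+1 Q.
Proof.
move=> ev Hp Hq; case: eqP => v0.
  rewrite v0 in ev; case: Hq => [|t [s' [ex tk h]]]; first by rewrite v0.
  exists (ecost e + t).+1, s'; split=> //; first exact: ExecIfFalse.
  by rewrite ltnS leq_add2l.
case: Hp => [|t [s' [ex tk h]]]; first exact/eqP.
exists (ecost e + t).+1, s'; split=> //; first by apply: ExecIfTrue ev _ ex; apply/eqP.
by rewrite ltnS leq_add2l.
Qed.

(** * Correctness and cost of the nested loops *)

Section Loops.
Variables (n : nat) (G : sgraph n) (nb : 'I_n -> seq 'I_n).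
Hypothesis nbG : adjacency_lists G nb.
Let A := adj (edges G).
Variable R : nat -> nat.
Hypothesis RE : forall i j, (R i == R j) = (i == j).
Hypothesis R_ge2 : forall i, 2 <= R i.
Variables (M D c : nat).
Hypotheses (nM : n.+1 < M) (D12 : 12 <= D) (Dc : 4 * D + 20 <= c).
Let X := M ^ D.
Let M1 : 1 < M. Proof. by lia. Qed.
Let D5c : D + 5 <= c. Proof. by lia. Qed.
Let nX : n <= X.
Proof. by apply: (@poly_leq _ _ _ nM D12 1); [rewrite expn1; lia | lia]. Qed.

Ltac simp := rewrite /= ?RE ?(R_neq0 R_ge2) ?(R_neq1 R_ge2) /=.

Record fill_invariant (es : seq ('I_n * 'I_n)) (s : state) : Prop := FillInvariant {
  fill_input : same_input nb s;
  fill_adj : forall x y : 'I_n, arr s (R 0) (x * n + y) = ((x, y) \in es);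
  fill_arr1 : forall i, arr s (R 1) i = 0;
  fill_arr2 : forall i, arr s (R 2) i = 0;
  fill_reg : forall j, 7 <= j -> reg s (R j) = 0 }.

Lemma fill_invariant_reg es s j x : j < 7 -> fill_invariant es s ->
  fill_invariant es (set_reg s (R j) x).
Proof.
move=> j7 [h0 h1 h2 h3 h4]; split=> //; first exact: same_input_reg.
by move=> k k7; rewrite /= RE; case: eqP => [?|_]; [lia | exact: h4].
Qed.

Lemma fill_invariant_input : fill_invariant [::] (input_state nb).
Proof.
have E0 i : (R i == 0) = false by rewrite eq_sym R_neq0.
have E1 i : (R i == 1) = false by rewrite eq_sym R_neq1.
by split=> [|x y|i|i|j _]; rewrite /= ?E0 ?E1.
Qed.

Lemma small_input : small X (input_state nb).
Proof.
have n2 : n ^ 2 <= X.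
  by apply: (@poly_leq _ _ _ nM D12 2); [rewrite leq_exp2r // ltnW // ltnW | lia].
split=> [r|a i] /=; first by case: ifP.
case: ifP => _.
  have [lt|ge] := ltnP i n.+1; last by rewrite nth_default // size_mkseq.
  rewrite nth_mkseq //; apply: leq_trans n2.
  apply: (@leq_trans (\sum_(u < n) n)); last by rewrite sum_nat_const card_ord.
  rewrite big_mkcond leq_sum // => u _; case: ifP => // _.
  by rewrite (size_nb nbG) deg_leq.
case: ifP => // _; have [lt|ge] := ltnP i (size (flatten [seq nb v | v <- enum 'I_n])).
  case: (flatten _) lt => // x l lt; rewrite (nth_map x) //.
  by apply: leq_trans nX; apply: ltnW.
by rewrite nth_default // size_map.
Qed.

Lemma ok_fill : ok (M ^ c) (fill_code R) (input_state nb)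
  (\sum_v (\sum_(w <- nb v) (8 + 11) + 12 + 8) + 6)
  (fun s => small X s /\ invariant G nb R [::] [::] [::] [::] s).
Proof.
pose es vs := [seq (v, u) | v <- vs, u <- nb v].
pose I vs s := fill_invariant (es vs) s.
apply: ok_weaken (ok_for_vertices (nb := nb) (I := I)
  (k := fun v => \sum_(w <- nb v) (8 + 11) + 12) M1 D5c nX _ _ _ _ _ _) _ _ => //.
- by move=> vs s [].
- by move=> vs s x; exact: fill_invariant_reg.
- by simp.
- move=> vs v vs' s E Is sm sv.
  pose J us s := fill_invariant (es vs ++ [seq (v, u) | u <- us]) s /\ reg s (R 0) = v.
  apply: ok_weaken (ok_for_neighbours (I := J) (v := v) (k := fun=> 8)
    RE M1 D5c nX _ _ _ _ _ _ _ _ _) _ _ => //.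
  + by move=> us s' [[]].
  + move=> us s' j y jin [J1 J2]; split.
      by apply: fill_invariant_reg => //; move: jin; rewrite !inE => /or3P[]/eqP->.
    by simp; move: jin; rewrite !inE => /or3P[]/eqP->.
  + move=> us w us' s' E' [J1 J2] sm' sw.
    apply: ok_weaken (ok_wp (D := D) (c := c) M1 sm' _
      (Q := J (rcons us w)) _) _ _ => //=; first by lia.
    case: J1 => h0 h1 h2 h3 h4; split; first by rewrite expn_gt0 ltnW.
    split; last by [].
    split; simp; rewrite ?J2 ?sw ?h0.1 //.
      exact: same_input_arr.
    move=> x y; rewrite cell_eq // h1 map_rcons -cats1 catA [in RHS]mem_cat mem_seq1.
    by case: eqP; rewrite ?orbT ?orbF.
  + by rewrite /J cats0.
  + move=> s' [sm' [J1 _]]; split=> //; rewrite /I /es.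
    by rewrite -cats1 map_cat flatten_cat /= cats0.
- exact: small_input.
- exact: fill_invariant_input.
- move=> s [sm [h0 h1 h2 h3 h4]]; split=> //.
  have Z (T : eqType) (F : T -> nat) : \sum_(x <- [::]) F x = 0 by rewrite big_nil.
  split=> //.
  + move=> x y; rewrite h1; congr nat_of_bool; apply/allpairsPdep/idP.
      by case=> v [u [_ uv [-> ->]]]; have [_] := nbG v; move/(_ u); rewrite uv.
    move=> xy; exists x, y; split=> //; first by rewrite mem_enum.
    by have [_ ->] := nbG x.
  + by move=> x y; rewrite h2 /codegree big_nil.
  + by move=> x y; rewrite h3 /wedges big_nil.
  + by rewrite h4 // /deg_sum big_nil.
  + by rewrite h4 // /cherry_sum big_nil.
  + by rewrite h4 // /claw_sum big_nil.
  + by rewrite h4 // /path_sum big_nil.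
  + by rewrite h4 // /triangle_sum big_nil.
  + by rewrite h4 // /paw_sum big_nil.
  + by rewrite h4 // /diamond_sum big1 // => p _; rewrite /codegree big_nil.
  + by rewrite h4 // /square_sum big1 // => p _; rewrite /wedges big_nil.
Qed.

Definition below_pairs (v : 'I_n) (us : seq 'I_n) : seq ('I_n * 'I_n) :=
  [seq (v, u) | u <- us & rank G u < rank G v].

Definition pairs_of (vs : seq 'I_n) : seq ('I_n * 'I_n) :=
  flatten [seq below_pairs v (nb v) | v <- vs].

(** The third vertex may be the first one again; such a triple contributes nothing, since a vertex
    is neither adjacent to itself nor ranked below itself. *)
Definition triples_of (ps : seq ('I_n * 'I_n)) : seq ('I_n * 'I_n * 'I_n) :=
  flatten [seq [seq (p, w) | w <- nb p.2] | p <- ps].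

Lemma size_pairs_of vs : size (pairs_of vs) <= size vs * n.
Proof.
rewrite size_flatten sumnE !big_map; apply: sum_seq_leq => v.
rewrite size_map size_filter (leq_trans (count_size _ _)) //.
by rewrite (size_nb nbG) deg_leq.
Qed.

Lemma size_triples_of ps : size (triples_of ps) <= size ps * n.
Proof.
rewrite size_flatten sumnE !big_map; apply: sum_seq_leq => v.
by rewrite size_map (size_nb nbG) deg_leq.
Qed.

Lemma triples_of_rcons ps p :
  triples_of (rcons ps p) = triples_of ps ++ [seq (p, w) | w <- nb p.2].
Proof. by rewrite -cats1 /triples_of map_cat flatten_cat /= cats0. Qed.

Lemma pairs_of_rcons vs v :
  pairs_of (rcons vs v) = pairs_of vs ++ below_pairs v (nb v).
Proof. by rewrite -cats1 /pairs_of map_cat flatten_cat /= cats0. Qed.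

Lemma below_pairs_rcons v us u : below_pairs v (rcons us u) =
  below_pairs v us ++ (if rank G u < rank G v then [:: (v, u)] else [::]).
Proof.
by rewrite /below_pairs -cats1 filter_cat map_cat /=; case: ifP.
Qed.

Let D1 : 1 <= D. Proof. by lia. Qed.
Let D2 : 2 <= D. Proof. by lia. Qed.
Let simp_max := (maxn_idPl D1, maxn_idPl D2, maxnn).

Lemma vertex_degree : prog_degree D (vertex_code R) <= c.
Proof. by rewrite /= !simp_max; lia. Qed.
Lemma pair_degree : prog_degree D (pair_code R) <= c.
Proof. by rewrite /= !simp_max; lia. Qed.
Lemma triangle_degree : prog_degree D (triangle_code R) <= c.
Proof. by rewrite /= !simp_max; lia. Qed.
Lemma wedge_degree : prog_degree D (wedge_code R) <= c.
Proof. by rewrite /= !simp_max; lia. Qed.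

(** The constants are costs of pieces: 60 for [vertex_code], 24 for [pair_code], 99 for
    [triangle_code] and [wedge_code] together, while 40 covers the comparison of ranks. The loop
    around a neighbour [u] is paid for only when [u] is the lower endpoint. *)
Lemma ok_count s0 : small X s0 -> invariant G nb R [::] [::] [::] [::] s0 ->
  ok (M ^ c) (count_code R) s0
  (\sum_v (60 + (\sum_(u <- nb v) (40 + (if rank G u < rank G v then 24 +
       (\sum_(w <- nb u) (99 + 11) + 12) else 1) + 11) + 12) + 8) + 6)
  (fun s => small X s /\
     invariant G nb R (enum 'I_n) (pairs_of (enum 'I_n))
       (triples_of (pairs_of (enum 'I_n))) (triples_of (pairs_of (enum 'I_n))) s).
Proof.
move=> sm0 I0.
pose I vs := let ps := pairs_of vs in
  invariant G nb R vs ps (triples_of ps) (triples_of ps).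
apply: (ok_for_vertices (nb := nb) (I := I) M1 D5c nX) => //; rewrite {I0 sm0 s0}.
- by move=> vs s [].
- by move=> vs s x; exact: invariant_reg.
- by simp.
move=> vs v vs' s E Is sm sv; rewrite {}/I /= in Is *.
have vsn : size vs < n.
  by rewrite -[X in _ < X](size_enum_ord n) E size_cat /=; lia.
apply: ok_seq.
have w0 : ~~ writes (R 0) (vertex_code R) by simp.
have H := wp_vertex nbG RE R_ge2 nM D12 Is vsn sv.
apply: ok_weaken (ok_writes w0 (ok_wp (c := c) M1 sm vertex_degree H)) _ _ => //=.
move=> s1 [[sm1 I1] s1v]; rewrite sv in s1v.
pose J us s := let ps := pairs_of vs ++ below_pairs v us in
  invariant G nb R (rcons vs v) ps (triples_of ps) (triples_of ps) s /\ reg s (R 0) = v.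
(* No list of pairs or triples ever exceeds this length, so one more item can always be appended
   within [M ^ 3]. *)
have M3 : n * n * n + n * n + n < M ^ 3.
  by apply: (@leq_trans (n.+2 ^ 3)); [rewrite !expnS expn0; nia | rewrite leq_exp2r].
apply: ok_weaken (ok_for_neighbours (I := J) (v := v)
  (k := fun u => 40 + (if rank G u < rank G v then 24 +
       (\sum_(w <- nb u) (99 + 11) + 12) else 1))
  RE M1 D5c nX _ _ _ _ _ _ _ _ _) _ _ => //.
- by move=> us s' [[]].
- move=> us s' j y jin [J1 J2]; split.
    by apply: invariant_reg => //; move: jin; rewrite !inE => /or3P[]/eqP->.
  by simp; move: jin; rewrite !inE => /or3P[]/eqP->.
- by simp.
- by simp.
- move=> us u us' s2 Eu [I2 s2v] sm2 s2u.
  have usn : size us < n.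
    apply: (@leq_trans (size (nb v))); last by rewrite (size_nb nbG) deg_leq.
    by rewrite Eu size_cat /=; lia.
  set ps := pairs_of vs ++ below_pairs v us in I2.
  have psn : size ps <= n * n.
    apply: (@leq_trans (size vs * n + n)); last by rewrite addnC -mulSn leq_mul.
    rewrite size_cat size_map size_filter leq_add ?size_pairs_of //.
    exact: leq_trans (count_size _ _) (ltnW usn).
  have tsn : size (triples_of ps) <= n * n * n.
    by apply: leq_trans (size_triples_of _) _; rewrite leq_mul.
  have hin := inv_input I2.
  have dv := same_input_deg nbG v hin; have du := same_input_deg nbG u hin.
  have [|ev _] := @eval_evaln M D c s2 (Op Lt (rank_expr (R 3)) (rank_expr (R 0))) M1 sm2.
    by rewrite /=; lia.
  apply: ok_weaken (ok_if ev (k := 24 + (\sum_(w <- nb u) (99 + 11) + 12)) (l := 1)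
    (Q := fun s' => small X s' /\ J (rcons us u) s') _ _) _ _ => //.
  + rewrite /= s2v s2u hin.1 dv du -!/(rank G _).
    case uv: (rank G u < rank G v) => // _.
    have p0 : ~~ writes (R 0) (pair_code R) by simp.
    have p3 : ~~ writes (R 3) (pair_code R) by simp.
    have psM : size ps < M ^ 3 by lia.
    have H2 := wp_pair nbG RE R_ge2 nM D12 I2 psM s2v s2u.
    apply: ok_seq.
    apply: ok_weaken (ok_writes p3 (ok_writes p0 (ok_wp (c := c) M1 sm2 pair_degree H2))) _ _ => //=.
    move=> s3 [[[sm3 I3] s3v] s3u]; rewrite s2v in s3v; rewrite s2u in s3u.
    pose K ws s := let ts := triples_of ps ++ [seq ((v, u), w) | w <- ws] in
      [/\ invariant G nb R (rcons vs v) (rcons ps (v, u)) ts ts s,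
          reg s (R 0) = v & reg s (R 3) = u].
    apply: ok_weaken (ok_for_neighbours (I := K) (v := u) (k := fun=> 99)
      RE M1 D5c nX _ _ _ _ _ _ _ _ _) _ _ => //.
    * by move=> ws s' [[]].
    * move=> ws s' j y jin [K1 K2 K3]; split.
      -- by apply: invariant_reg => //; move: jin; rewrite !inE => /or3P[]/eqP->.
      -- by simp; move: jin; rewrite !inE => /or3P[]/eqP->.
      -- by simp; move: jin; rewrite !inE => /or3P[]/eqP->.
    * by simp.
    * by simp.
    * move=> ws w ws' s4 Ew [I4 s4v s4u] sm4 s4w.
      have wsn : size ws < n.
        apply: (@leq_trans (size (nb u))); last by rewrite (size_nb nbG) deg_leq.
        by rewrite Ew size_cat /=; lia.
      have tsM : size (triples_of ps ++ [seq (v, u, w) | w <- ws]) < M ^ 3.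
        by rewrite size_cat size_map; lia.
      have H4 := wp_triangle nbG RE R_ge2 nM D12 I4 tsM s4v s4u s4w.
      have t0 : ~~ writes (R 0) (triangle_code R) by simp.
      have t3 : ~~ writes (R 3) (triangle_code R) by simp.
      have t6 : ~~ writes (R 6) (triangle_code R) by simp.
      (* The bounds are 50 for [triangle_code] and 49 for [wedge_code]. *)
      rewrite -[99]/(50 + 49); apply: ok_seq.
      apply: ok_weaken
        (ok_writes t6 (ok_writes t3 (ok_writes t0 (ok_wp (c := c) M1 sm4 triangle_degree H4)))) _ _ => //=.
      move=> s5 [[[[sm5 I5] s5v] s5u] s5w].
      rewrite s4v in s5v; rewrite s4u in s5u; rewrite s4w in s5w.
      have H5 := wp_wedge nbG RE R_ge2 nM D12 u I5 tsM s5v s5w.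
      have d0 : ~~ writes (R 0) (wedge_code R) by simp.
      have d3 : ~~ writes (R 3) (wedge_code R) by simp.
      apply: ok_weaken (ok_writes d3 (ok_writes d0 (ok_wp (c := c) M1 sm5 wedge_degree H5))) _ _ => //=.
      move=> s6 [[[sm6 I6] s6v] s6u]; split=> //.
      by split; [rewrite map_rcons -rcons_cat | rewrite s6v | rewrite s6u].
    * by rewrite /K cats0.
    * move=> s7 [sm7 [I7 s7v _]]; split=> //; split=> //.
      have -> : pairs_of vs ++ below_pairs v (rcons us u) = rcons ps (v, u).
        by rewrite below_pairs_rcons uv catA cats1.
      by rewrite triples_of_rcons.
  + rewrite /= s2v s2u hin.1 dv du -!/(rank G _).
    case uv: (rank G u < rank G v) => // _.
    exists 1, s2; split=> //; first by constructor.
    split=> //; split=> //.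
    by rewrite below_pairs_rcons uv cats0.
  + rewrite /= s2v s2u hin.1 dv du -!/(rank G _).
    by case uv: (rank G u < rank G v) => /=; lia.
- by rewrite /J cats0.
- move=> s' [sm' [J1 _]]; split=> //.
  by rewrite pairs_of_rcons.
Qed.

End Loops.

(** * The totals computed *)

Section Totals.
Variables (n : nat) (G : sgraph n) (nb : 'I_n -> seq 'I_n).
Hypothesis nbG : adjacency_lists G nb.
Let A := adj (edges G).

Lemma sum_neighbours v (F : 'I_n -> nat) : \sum_(u <- nb v) F u = \sum_(u | A v u) F u.
Proof.
have [u1 u2] := nbG v; rewrite big_uniq //; apply: eq_bigl => u; exact: u2.
Qed.

Lemma sum_pairs_of (F : 'I_n * 'I_n -> nat) :
  \sum_(p <- pairs_of G nb (enum 'I_n)) F p =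
  \sum_v \sum_(u | A v u && (rank G u < rank G v)) F (v, u).
Proof.
rewrite big_flatten big_map big_enum; apply: eq_bigr => v _.
by rewrite big_map big_filter big_mkcond sum_neighbours -big_mkcondr.
Qed.

Lemma sum_triples_of ps (F : 'I_n * 'I_n * 'I_n -> nat) :
  \sum_(t <- triples_of nb ps) F t = \sum_(p <- ps) \sum_(w | A p.2 w) F (p, w).
Proof.
rewrite big_flatten big_map; apply: eq_bigr => p _.
by rewrite big_map sum_neighbours.
Qed.

Definition all_pairs := pairs_of G nb (enum 'I_n).
Definition all_triples := triples_of nb all_pairs.

Variable R : nat -> nat.
Hypothesis RE : forall i j, (R i == R j) = (i == j).
Hypothesis R_ge2 : forall i, 2 <= R i.
Variables (M D c : nat).
Hypotheses (nM : n.+1 < M) (D12 : 12 <= D) (Dc : 4 * D + 20 <= c).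

(** With [m] edges and arboricity [a], the two loops cost at most
    [100 * n + 212 * m + 220 * a * m + 12]: the degrees sum to at most [2 * m], those of lower
    endpoints to at most [2 * a * m]. Then [m <= a * m] gives the factor 500. *)
Lemma ok_fill_count : ok (M ^ c) (Seq (fill_code R) (count_code R)) (input_state nb)
  (500 * (n + arboricity G * #|edges G|) + 12)
  (fun s => small (M ^ D) s /\
     invariant G nb R (enum 'I_n) all_pairs all_triples all_triples s).
Proof.
have H := ok_fill nbG RE R_ge2 nM D12 Dc.
apply: (@ok_weaken _ _ _ _ _ _ _ (ok_seq (ok_weaken H (leqnn _) (fun s Hs =>
  ok_count nbG RE R_ge2 nM D12 Dc (proj1 Hs) (proj2 Hs))))) => //.
set m := #|edges G|.
have hm : m <= arboricity G * m.
  by case: (posnP m) => [-> //|m0]; rewrite leq_pmull // arboricity_gt0.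
have s1 : \sum_v deg G v <= 2 * m := sum_deg G.
have s2 := sum_deg_below G.
have e1 : \sum_v (\sum_(w <- nb v) (8 + 11) + 12 + 8) = 19 * (\sum_v deg G v) + 20 * n.
  rewrite big_distrr /= [20 * n]mulnC -[in n * 20](card_ord n) -sum_nat_const -big_split /=.
  apply: eq_bigr => v _; rewrite -addnA; congr (_ + _).
  by rewrite big_const_seq count_predT iter_addn_0 (size_nb nbG).
have e2 : \sum_v (60 + (\sum_(u <- nb v) (40 + (if rank G u < rank G v then 24 +
       (\sum_(w <- nb u) (99 + 11) + 12) else 1) + 11) + 12) + 8) <=
    80 * n + 87 * (\sum_v deg G v) +
    110 * (\sum_v \sum_(u | adj (edges G) v u && (rank G u < rank G v)) deg G u).
  apply: (@leq_trans (\sum_v (80 + 87 * deg G v +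
     110 * (\sum_(u | adj (edges G) v u && (rank G u < rank G v)) deg G u)))); last first.
    rewrite 2!big_split /= sum_nat_const card_ord [n * 80]mulnC.
    apply: leq_add; first apply: leq_add; first exact: leqnn.
      by apply/eq_leq; symmetry; exact: big_distrr.
    by apply/eq_leq; symmetry; exact: big_distrr.
  apply: leq_sum => v _; rewrite big_mkcondr -sum_neighbours.
  have -> : deg G v = \sum_(u <- nb v) 1.
    by rewrite sum1_size (size_nb nbG).
  rewrite 2!big_distrr /= -[X in _ <= X]addnA -big_split /=.
  have : \sum_(u <- nb v) (40 + (if rank G u < rank G v then 24 +
       (\sum_(w <- nb u) (99 + 11) + 12) else 1) + 11) <= \sum_(u <- nb v)
       (87 * 1 + 110 * (if rank G u < rank G v then deg G u else 0)).
    apply: leq_sum => u _; case: ifP => _; last by [].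
    rewrite big_const_seq count_predT iter_addn_0 (size_nb nbG); lia.
  lia.
lia.
Qed.

Lemma total_deg : deg_sum G (enum 'I_n) = \sum_v deg G v.
Proof. by rewrite /deg_sum big_enum. Qed.

Lemma total_cherry : cherry_sum G (enum 'I_n) = \sum_v deg G v * (deg G v - 1).
Proof. by rewrite /cherry_sum big_enum. Qed.

Lemma total_claw : claw_sum G (enum 'I_n) =
  \sum_v deg G v * ((deg G v - 1) * (deg G v - 2)).
Proof. by rewrite /claw_sum big_enum. Qed.

(** Each edge is processed once, from its higher ranked endpoint. *)
Lemma sum_below_double (F : 'I_n -> 'I_n -> nat) : (forall x y, F x y = F y x) ->
  \sum_v \sum_(u | A v u && (rank G u < rank G v)) 2 * F v u =
  \sum_v \sum_(u | A v u) F v u.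
Proof.
move=> Fs; set L := \sum_v \sum_(u | A v u && (rank G u < rank G v)) F v u.
transitivity (2 * L).
  by rewrite big_distrr; apply: eq_bigr => v _; rewrite big_distrr.
have -> : \sum_v \sum_(u | A v u) F v u =
    L + \sum_v \sum_(u | A v u && (rank G v < rank G u)) F v u.
  rewrite -big_split; apply: eq_bigr => v _ /=.
  rewrite (bigID (fun u => rank G u < rank G v)) /=; congr (_ + _).
  apply: eq_bigl => u; case Avu : (A v u) => //=.
  have ne : rank G u != rank G v.
    by apply: contraTneq Avu => /rank_inj ->; rewrite /A adj_irr.
  by rewrite -leqNgt ltn_neqAle eq_sym ne.
rewrite mul2n -addnn; congr (_ + _); rewrite /L (exchange_big_dep predT) //=.
by apply: eq_bigr => v _; apply: eq_big => [u|u _]; [rewrite /A adj_sym | exact: Fs].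
Qed.

Definition common (x y : 'I_n) : nat := \sum_w (A x w && A y w).

Lemma common_sym x y : common x y = common y x.
Proof. by apply: eq_bigr => w _; rewrite andbC. Qed.

Lemma sum_adj_common (F : 'I_n -> nat) v u :
  \sum_(w | A u w) A v w * F w = \sum_w (A v w && A u w) * F w.
Proof.
rewrite [LHS]big_mkcond; apply: eq_bigr => w _.
by case: (A u w); rewrite ?andbT ?andbF.
Qed.

Lemma total_path : path_sum G all_pairs =
  \sum_v \sum_(u | A v u) (deg G v - 1) * (deg G u - 1).
Proof.
by rewrite /path_sum sum_pairs_of sum_below_double // => x y; rewrite mulnC.
Qed.

Lemma total_triangle : triangle_sum G all_triples = \sum_v \sum_(u | A v u) common v u.
Proof.
rewrite /triangle_sum sum_triples_of sum_pairs_of /= -(sum_below_double common_sym).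
apply: eq_bigr => v _; apply: eq_bigr => u _.
rewrite -big_distrr /=; congr (2 * _).
rewrite (eq_bigr (fun w => A v w * 1)) => [|w _]; last by rewrite muln1.
by rewrite sum_adj_common; apply: eq_bigr => w _; rewrite muln1.
Qed.

Lemma total_paw : paw_sum G all_triples =
  \sum_v \sum_(u | A v u) \sum_w (A v w && A u w) * (deg G w - 2).
Proof.
rewrite /paw_sum sum_triples_of sum_pairs_of /=.
rewrite -(sum_below_double (F := fun v u => \sum_w (A v w && A u w) * (deg G w - 2))); last first.
  by move=> x y; apply: eq_bigr => w _; rewrite andbC.
apply: eq_bigr => v _; apply: eq_bigr => u _.
by rewrite -big_distrr /= sum_adj_common.
Qed.

Lemma codegree_total v u : codegree G all_triples (v, u) =
  if A v u && (rank G u < rank G v) then common v u else 0.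
Proof.
rewrite /codegree sum_triples_of sum_pairs_of /=.
rewrite (bigD1 v) //= [X in _ + X]big1 ?addn0 => [|x xv]; last first.
  by apply: big1 => y _; apply: big1 => w _; rewrite xpair_eqE (negPf xv).
rewrite big_mkcond (bigD1 u) //= [X in _ + X]big1 ?addn0 => [|y yu]; last first.
  by case: ifP => // _; apply: big1 => w _; rewrite xpair_eqE (negPf yu) andbF.
case: ifP => // _; rewrite big_mkcond; apply: eq_bigr => w _.
by rewrite eqxx /= andbC; case: (A u w).
Qed.

Lemma total_diamond : diamond_sum G all_triples =
  \sum_v \sum_(u | A v u) common v u * (common v u - 1).
Proof.
rewrite -(sum_below_double (F := fun v u => common v u * (common v u - 1))); last first.
  by move=> x y; rewrite common_sym.
rewrite /diamond_sum big_distrr pair_big_dep /= [RHS]big_mkcond.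
by apply: eq_bigr => -[v u] _; rewrite codegree_total; case: ifP.
Qed.

Definition lower_common (v w : 'I_n) : nat :=
  \sum_(u | rank G u < rank G v) (A v u && A u w).

Lemma wedges_total v w : wedges G all_triples (v, w) =
  if rank G w < rank G v then lower_common v w else 0.
Proof.
rewrite /wedges sum_triples_of sum_pairs_of /=.
rewrite (bigD1 v) //= [X in _ + X]big1 ?addn0 => [|x xv]; last first.
  by apply: big1 => y _; apply: big1 => z _; rewrite xpair_eqE (negPf xv).
rewrite /lower_common [in RHS]big_mkcond [LHS]big_mkcond /=.
transitivity (\sum_u (if rank G w < rank G v then
    (if rank G u < rank G v then (A v u && A u w : nat) else 0) else 0)); last first.
  by case: ifP => // _; rewrite big1.
apply: eq_bigr => u _; case uv: (rank G u < rank G v); last first.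
  by rewrite andbF; case: ifP.
rewrite andbT; case: (A v u) => /=; last by case: ifP.
rewrite big_mkcond (bigD1 w) //= [X in _ + X]big1 ?addn0 => [|z zw]; last first.
  by case: ifP => // _; rewrite xpair_eqE (negPf zw) andbF.
by rewrite eqxx /=; case: (A u w); case: ifP.
Qed.

Lemma total_square : square_sum G all_triples =
  \sum_v \sum_(w | rank G w < rank G v) lower_common v w * (lower_common v w - 1).
Proof.
rewrite /square_sum pair_big_dep /= [RHS]big_mkcond.
by apply: eq_bigr => -[v w] _; rewrite wedges_total; case: ifP.
Qed.

End Totals.

(** * Injective homomorphisms from graphs on four vertices *)

Lemma count_card (T : finType) (P : pred T) (s : seq T) : uniq s ->
  count P s = #|[predI P & s]|.
Proof.
move=> us; rewrite -size_filter -(card_uniqP (filter_uniq P us)).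
by apply: eq_card => x; rewrite mem_filter !inE.
Qed.

Lemma card_notin (T : finType) (P : pred T) (s : seq T) : uniq s ->
  \sum_(x | (x \notin s) && P x) 1 = #|P| - count P s.
Proof.
move=> us; rewrite sum1_card (count_card P us) -[#|P|](cardID (mem s)) addKn.
by apply: eq_card => x; rewrite !inE andbC.
Qed.

Lemma count_leq_card (T : finType) (P : pred T) (s : seq T) : uniq s -> count P s <= #|P|.
Proof.
by move=> us; rewrite count_card //; apply/subset_leq_card/subsetP => x /andP[].
Qed.

Section Patterns.
Variables (n : nat) (G : sgraph n).
Let A := adj (edges G).

Lemma deg_card v : #|A v| = deg G v.
Proof. by rewrite -sum1_card big_mkcond; apply: eq_bigr => u _; rewrite -topredE /= -/A; case: (A v u). Qed.

Lemma common_card a b : #|[pred x | A a x && A b x]| = common G a b.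
Proof. by rewrite -sum1_card big_mkcond; apply: eq_bigr => u _; rewrite inE -/A; case: (_ && _). Qed.

Definition respects (x : 'I_n * 'I_n * 'I_n * 'I_n) (P : seq (nat * nat)) : bool :=
  let: (a, b, c, d) := x in
  all (fun e => A (nth a [:: a; b; c; d] e.1) (nth a [:: a; b; c; d] e.2)) P.

(** The number of injective maps from four vertices, numbered 0 to 3, that
    preserve the edges listed in [P]. *)
Definition inj4 (P : seq (nat * nat)) : nat :=
  \sum_a \sum_b \sum_c \sum_d
    [&& b \notin [:: a], c \notin [:: b; a], d \notin [:: c; b; a]
      & respects (a, b, c, d) P].

(** Vertices are chosen one after the other, [c1], [c2], [c3] being the edges back to earlier ones.
    The last choice is counted as all candidates minus those already taken, which yields closed
    formulas in degrees and codegrees. *)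
Lemma nested_inj4 P (c1 : rel 'I_n) (c2 : 'I_n -> rel 'I_n) (c3 : 'I_n -> 'I_n -> rel 'I_n) :
  (forall a b c d, respects (a, b, c, d) P = [&& c1 a b, c2 a b c & c3 a b c d]) ->
  inj4 P =
  \sum_a \sum_(b | (b \notin [:: a]) && c1 a b)
    \sum_(c | (c \notin [:: b; a]) && c2 a b c) (#|c3 a b c| - count (c3 a b c) [:: c; b; a]).
Proof.
move=> PE; apply: eq_bigr => a _; rewrite [RHS]big_mkcond; apply: eq_bigr => b _.
have E c d : [&& b \notin [:: a], c \notin [:: b; a], d \notin [:: c; b; a]
      & respects (a, b, c, d) P] =
    [&& (b \notin [:: a]) && c1 a b, (c \notin [:: b; a]) && c2 a b c
      & (d \notin [:: c; b; a]) && c3 a b c d].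
  by rewrite PE; case: (b \notin _); case: (c \notin _); case: (d \notin _); rewrite /= ?andbF.
case h1: (_ && c1 a b); last by rewrite big1 // => c _; rewrite big1 // => d _; rewrite E h1.
rewrite [RHS]big_mkcond; apply: eq_bigr => c _.
case h2: (_ && c2 a b c); last by rewrite big1 // => d _; rewrite E h1 h2.
rewrite -card_notin; last first.
  by case/andP: h1 => h1 _; case/andP: h2 => h2 _; rewrite cons_uniq h2 /= h1.
by rewrite [RHS]big_mkcond; apply: eq_bigr => d _; rewrite E h1 h2 /=; case: ifP.
Qed.

Let Airr x : A x x = false := adj_irr G x.
Let Asym x y : A x y = A y x := adj_sym _ x y.

Lemma sum_edge (F : 'I_n -> nat) a :
  \sum_(b | (b \notin [:: a]) && A a b) F b = \sum_(b | A a b) F b.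
Proof.
apply: eq_bigl => b; rewrite inE; case: eqP => //= ->; by rewrite Airr.
Qed.

Lemma sum_edge_const a k : \sum_(b | A a b) k = deg G a * k.
Proof. by rewrite sum_nat_const -deg_card. Qed.

Let cardT : #|fun _ : 'I_n => true| = n. Proof. by rewrite -[RHS](card_ord n). Qed.

Lemma sum_notin1 (a : 'I_n) k : \sum_(b | (b \notin [:: a]) && true) k = (n - 1) * k.
Proof. by rewrite -[k in LHS]mul1n -big_distrl card_notin //= cardT. Qed.

Lemma sum_notin2 (a b : 'I_n) k : b \notin [:: a] ->
  \sum_(c | (c \notin [:: b; a]) && true) k = (n - 2) * k.
Proof. by move=> ba; rewrite -[k in LHS]mul1n -big_distrl card_notin /= ?cardT ?ba. Qed.

Lemma sum_notin_edge (a b : 'I_n) k : b \notin [:: a] -> A a b ->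
  \sum_(c | (c \notin [:: b; a]) && A a c) k = (deg G a - 1) * k.
Proof.
move=> ba ab; rewrite -[k in LHS]mul1n -big_distrl card_notin /= ?ba //.
by rewrite deg_card ab Airr.
Qed.

Lemma sum_common a b (F : 'I_n -> nat) :
  \sum_(c | (c \notin [:: b; a]) && (A a c && A b c)) F c =
  \sum_(c | A a c && A b c) F c.
Proof.
apply: eq_bigl => c; rewrite !inE negb_or.
case: eqP => [->|_]; first by rewrite Airr andbF.
by case: eqP => [->|_]; first by rewrite Airr.
Qed.

Lemma notin_edge a b : A a b -> b \notin [:: a].
Proof. by rewrite inE; apply: contraTneq => ->; rewrite Airr. Qed.

Lemma inj4_empty : inj4 [::] = n * ((n - 1) * ((n - 2) * (n - 3))).
Proof.
rewrite (@nested_inj4 _ (fun _ _ => true) (fun _ _ _ => true)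
  (fun _ _ _ _ => true)) => [|a b c d] //.
rewrite (eq_bigr (fun=> (n - 1) * ((n - 2) * (n - 3)))) => [|a _].
  by rewrite sum_nat_const card_ord.
rewrite -(sum_notin1 a); apply: eq_bigr => b /andP[ba _].
by rewrite -(sum_notin2 _ ba); apply: eq_bigr => c _; rewrite cardT.
Qed.

Lemma inj4_edge : inj4 [:: (0, 1)] = (\sum_v deg G v) * ((n - 2) * (n - 3)).
Proof.
rewrite (@nested_inj4 _ (fun a b => A a b) (fun _ _ _ => true)
  (fun _ _ _ _ => true)) => [|a b c d] //.
rewrite big_distrl; apply: eq_bigr => a _ /=.
rewrite -sum_edge_const -sum_edge; apply: eq_bigr => b /andP[ba _].
by rewrite -(sum_notin2 _ ba); apply: eq_bigr => c _; rewrite cardT.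
Qed.

Lemma inj4_cherry : inj4 [:: (0, 1); (0, 2)] =
  (\sum_v deg G v * (deg G v - 1)) * (n - 3).
Proof.
rewrite (@nested_inj4 _ (fun a b => A a b) (fun a _ c => A a c)
  (fun _ _ _ _ => true)) => [|a b c d]; last by rewrite /= !andbT.
rewrite big_distrl; apply: eq_bigr => a _ /=.
rewrite -mulnA -sum_edge_const -sum_edge; apply: eq_bigr => b /andP[ba ab].
by rewrite -(sum_notin_edge _ ba ab); apply: eq_bigr => c _; rewrite cardT.
Qed.

Lemma inj4_triangle : inj4 [:: (0, 1); (0, 2); (1, 2)] =
  (\sum_v \sum_(u | A v u) common G v u) * (n - 3).
Proof.
rewrite (@nested_inj4 _ (fun a b => A a b) (fun a b c => A a c && A b c)
  (fun _ _ _ _ => true)) => [|a b c d]; last by rewrite /= !andbT.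
rewrite big_distrl; apply: eq_bigr => a _ /=.
rewrite sum_edge big_distrl; apply: eq_bigr => b ab /=.
by rewrite sum_common -common_card -sum_nat_const; apply: eq_bigr => c _; rewrite cardT.
Qed.

Lemma inj4_claw : inj4 [:: (0, 1); (0, 2); (0, 3)] =
  \sum_v deg G v * ((deg G v - 1) * (deg G v - 2)).
Proof.
rewrite (@nested_inj4 _ (fun a b => A a b) (fun a _ c => A a c)
  (fun a _ _ d => A a d)) => [|a b c d]; last by rewrite /= !andbT.
apply: eq_bigr => a _ /=.
rewrite -sum_edge_const -sum_edge; apply: eq_bigr => b /andP[ba ab].
rewrite -(sum_notin_edge _ ba ab); apply: eq_bigr => c /andP[_ ac].
by rewrite deg_card ac ab Airr.
Qed.

Lemma inj4_paw : inj4 [:: (0, 1); (0, 2); (1, 2); (2, 3)] =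
  \sum_v \sum_(u | A v u) \sum_w (A v w && A u w) * (deg G w - 2).
Proof.
rewrite (@nested_inj4 _ (fun a b => A a b) (fun a b c => A a c && A b c)
  (fun _ _ c d => A c d)) => [|a b c d]; last by rewrite /= !andbT -!andbA.
apply: eq_bigr => a _; rewrite sum_edge; apply: eq_bigr => b ab.
rewrite sum_common big_mkcond; apply: eq_bigr => c _.
case: ifP => [/andP[ac bc]|_] //; rewrite mul1n deg_card /=.
by rewrite Airr !(Asym c) ac bc.
Qed.

Lemma inj4_diamond : inj4 [:: (0, 1); (0, 2); (1, 2); (0, 3); (1, 3)] =
  \sum_v \sum_(u | A v u) common G v u * (common G v u - 1).
Proof.
rewrite (@nested_inj4 _ (fun a b => A a b) (fun a b c => A a c && A b c)
  (fun a b _ d => A a d && A b d)) => [|a b c d]; last by rewrite /= !andbT -!andbA.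
apply: eq_bigr => a _; rewrite sum_edge; apply: eq_bigr => b ab.
rewrite sum_common -common_card -sum_nat_const; apply: eq_bigr => c /andP[ac bc].
by rewrite /= ac bc !Airr andbF.
Qed.

(** For an oriented middle edge, the product counts independent choices of the two ends; these
    coincide exactly when they form a triangle with the edge. The additive form avoids truncated
    subtraction. *)
Lemma inj4_path :
  inj4 [:: (0, 1); (0, 2); (1, 3)] + \sum_v \sum_(u | A v u) common G v u =
  \sum_v \sum_(u | A v u) (deg G v - 1) * (deg G u - 1).
Proof.
rewrite (@nested_inj4 _ (fun a b => A a b) (fun a _ c => A a c)
  (fun _ b _ d => A b d)) => [|a b c d]; last by rewrite /= !andbT.
rewrite -big_split; apply: eq_bigr => a _ /=; rewrite sum_edge -big_split.
apply: eq_bigr => b ab /=; have ba := notin_edge ab.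
have -> : common G a b = \sum_(c | (c \notin [:: b; a]) && A a c) A b c.
  rewrite [RHS]big_mkcond; apply: eq_bigr => c _; rewrite -/A !inE negb_or.
  case: (eqVneq c b) => [->|_] /=; first by rewrite Airr ?andbF.
  case: (eqVneq c a) => [->|_] /=; first by rewrite Airr ?andbF.
  by case: (A a c).
rewrite -(sum_notin_edge _ ba ab) -big_split; apply: eq_bigr => c /andP[ca ac] /=.
have := @count_leq_card _ (A b) [:: c; b; a]; rewrite cons_uniq ca /= ba => /(_ isT).
by rewrite deg_card Airr (Asym b a) ab; lia.
Qed.

Lemma sum_edge_fst (F : 'I_n -> nat) : \sum_a \sum_(b | A a b) F a = \sum_a deg G a * F a.
Proof. by apply: eq_bigr => a _; rewrite sum_edge_const. Qed.

Lemma sum_edge_snd (F : 'I_n -> nat) : \sum_a \sum_(b | A a b) F b = \sum_a deg G a * F a.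
Proof.
rewrite -sum_edge_fst [LHS](exchange_big_dep predT) //=.
by apply: eq_bigr => a _; apply: eq_bigl => b; rewrite Asym.
Qed.

(** The right side counts pairs of oriented edges. They share exactly one vertex in four
    arrangements, each counted by the cherries, and two vertices when they are equal or reversed. *)
Lemma inj4_matching :
  inj4 [:: (0, 1); (2, 3)] +
    (4 * (\sum_v deg G v * (deg G v - 1)) + 2 * (\sum_v deg G v)) =
  (\sum_v deg G v) * (\sum_v deg G v).
Proof.
rewrite (@nested_inj4 _ (fun a b => A a b) (fun _ _ _ => true)
  (fun _ _ c d => A c d)) => [|a b c d]; last by rewrite /= !andbT.
set m := \sum_v deg G v.
have -> : 4 * (\sum_v deg G v * (deg G v - 1)) + 2 * m =
    \sum_a \sum_(b | A a b) (2 * (deg G a - 1) + 2 * (deg G b - 1) + 2).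
  transitivity (\sum_a \sum_(b | A a b) 2 * (deg G a - 1) +
      \sum_a \sum_(b | A a b) 2 * (deg G b - 1) + \sum_a \sum_(b | A a b) 2); last first.
    by rewrite -!big_split; apply: eq_bigr => a _; rewrite -!big_split.
  have -> : \sum_a \sum_(b | A a b) 2 * (deg G b - 1) =
    \sum_a \sum_(b | A a b) 2 * (deg G a - 1).
    by rewrite (sum_edge_snd (fun b => 2 * _)) -(sum_edge_fst (fun b => 2 * _)).
  have -> : \sum_a \sum_(b | A a b) 2 = 2 * m.
    by rewrite big_distrr; apply: eq_bigr => a _; rewrite sum_edge_const mulnC.
  have -> : \sum_a \sum_(b | A a b) 2 * (deg G a - 1) =
      2 * \sum_v deg G v * (deg G v - 1).
    by rewrite big_distrr; apply: eq_bigr => a _; rewrite sum_edge_const mulnCA.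
  lia.
rewrite -big_split -[RHS]/((\sum_v deg G v) * m) [RHS]big_distrl; apply: eq_bigr => a _ /=.
rewrite sum_edge -big_split -sum_edge_const; apply: eq_bigr => b ab /=.
have ba := notin_edge ab; have ab' : a \notin [:: b] by move: ba; rewrite !inE eq_sym.
have mE : m = \sum_(c | (c \notin [:: b; a]) && true) deg G c + deg G a + deg G b.
  rewrite /m (bigD1 a) //= (bigD1 b) /=; last by rewrite -mem_seq1.
  rewrite addnCA addnC [deg G a + _]addnC; congr (_ + _ + _).
  by apply: eq_bigl => c; rewrite !inE negb_or andbT andbC.
have e1 x y : A x y -> y \notin [:: x] ->
    \sum_(c | (c \notin [:: y; x]) && true) A c x = deg G x - 1.
  move=> xy yx; rewrite -[RHS]muln1 -(sum_notin_edge _ yx xy) [LHS]big_mkcond [RHS]big_mkcond.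
  by apply: eq_bigr => c _; rewrite andbT Asym; case: (c \notin _); case: (A x c).
have e2 : \sum_(c | (c \notin [:: b; a]) && true) A c b = deg G b - 1.
  rewrite -(e1 b a) // ?[A b a]Asym //; apply: eq_bigl => c.
  by rewrite !inE orbC.
(* For [c] outside the first edge, the neighbours of [c] excluded as values of [d] are those among
   [a] and [b]; summing over [c] gives the last two terms. *)
have e3 : \sum_(c | (c \notin [:: b; a]) && true) deg G c =
  \sum_(c | (c \notin [:: b; a]) && true) (#|A c| - count (A c) [:: c; b; a])
  + (deg G a - 1) + (deg G b - 1).
  rewrite -(e1 a b) // -e2 -!big_split; apply: eq_bigr => c /andP[cab _] /=.
  have := @count_leq_card _ (A c) [:: c; b; a]; rewrite cons_uniq cab /= ba => /(_ isT).
  by rewrite deg_card Airr; lia.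
have da : 0 < deg G a by rewrite -deg_card; apply/card_gt0P; exists b.
have db : 0 < deg G b by rewrite -deg_card; apply/card_gt0P; exists a; rewrite -topredE /= Asym.
rewrite mE e3 /=; move: (\sum_(c | _) _) => S; lia.
Qed.

Lemma unique_top (a b c d : nat) : uniq [:: a; b; c; d] ->
  [&& b < a, c < a & d < a] + [&& a < b, c < b & d < b] +
  [&& d < c, a < c & b < c] + [&& c < d, a < d & b < d] = 1.
Proof.
rewrite /= !inE !negb_or andbT -!andbA => /and5P[ab ac ad bc /andP[bd cd]].
by case: (ltngtP a b) ab; case: (ltngtP a c) ac; case: (ltngtP a d) ad;
  case: (ltngtP b c) bc; case: (ltngtP b d) bd; case: (ltngtP c d) cd => //=; lia.
Qed.

Let sum4 (F : 'I_n -> 'I_n -> 'I_n -> 'I_n -> nat) :=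
  \sum_a \sum_b \sum_c \sum_d F a b c d.

Let sum4_swap12 F : sum4 (fun a b c d => F b a c d) = sum4 F.
Proof. exact: exchange_big. Qed.

Let sum4_swap23 F : sum4 (fun a b c d => F a c b d) = sum4 F.
Proof. by apply: eq_bigr => a _; exact: exchange_big. Qed.

Let sum4_swap34 F : sum4 (fun a b c d => F a b d c) = sum4 F.
Proof. by apply: eq_bigr => a _; apply: eq_bigr => b _; exact: exchange_big. Qed.

(** Split the 4-cycles on the position of their highest ranked vertex. *)
Lemma inj4_square : inj4 [:: (0, 2); (0, 3); (1, 2); (1, 3)] =
  4 * \sum_v \sum_(w | rank G w < rank G v)
        lower_common G v w * (lower_common G v w - 1).
Proof.
pose Q a b c d := [&& b \notin [:: a], c \notin [:: b; a], d \notin [:: c; b; a]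
      & respects (a, b, c, d) [:: (0, 2); (0, 3); (1, 2); (1, 3)]].
pose top (a b c d : 'I_n) :=
  [&& rank G b < rank G a, rank G c < rank G a & rank G d < rank G a].
(* [F] keeps the 4-cycles whose highest vertex is [a]. Opposite to it is [b], and [c], [d] are the
   middle vertices of the two paths. *)
pose F a b c d : nat := Q a b c d && top a b c d.
have Q12 a b c d : Q b a c d = Q a b c d.
  rewrite /Q /= !inE !negb_or !andbT (eq_sym a b).
  by case: (b != a) (c != a) (c != b) (d != a) (d != b) (d != c) (A a c) (A a d) (A b c)
    (A b d) => [] [] [] [] [] [] [] [] [] [].
have Q1324 a b c d : Q c d a b = Q a b c d.
  rewrite /Q /= !inE !negb_or !andbT (eq_sym a c) (eq_sym a d) (eq_sym b a) (eq_sym b c).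
  rewrite (eq_sym b d) (eq_sym a b) !(Asym c) !(Asym d).
  by case: (b != a) (c != a) (c != b) (d != a) (d != b) (d != c) (A a c) (A a d) (A b c)
    (A b d) => [] [] [] [] [] [] [] [] [] [].
have FE : sum4 F = \sum_v \sum_(w | rank G w < rank G v)
        lower_common G v w * (lower_common G v w - 1).
  apply: eq_bigr => a _; rewrite [RHS]big_mkcond; apply: eq_bigr => b _.
  case ba: (rank G b < rank G a); last first.
    by rewrite big1 // => c _; rewrite big1 // => d _; rewrite /F /top ba andbF.
  pose L u := (rank G u < rank G a) && (A a u && A u b).
  have bna : b \notin [:: a] by rewrite inE; apply: contraTneq ba => ->; rewrite ltnn.
  have LE : lower_common G a b = #|L|.
    rewrite -sum1_card /lower_common big_mkcond [RHS]big_mkcond; apply: eq_bigr => u _.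
    by rewrite -topredE /= /L -/A; case: ifP => //= _; case: (_ && _).
  have La : L a = false by rewrite /L ltnn.
  have Lb : L b = false by rewrite /L Airr !andbF.
  transitivity (\sum_(c | (c \notin [:: b; a]) && L c) (#|L| - 1)); last first.
    rewrite -[#|L| - 1]mul1n -big_distrl card_notin /= ?La ?Lb ?addn0 ?subn0 ?LE ?mul1n //.
    by rewrite bna.
  rewrite [RHS]big_mkcond; apply: eq_bigr => c _.
  case cc: ((c \notin [:: b; a]) && L c); last first.
    rewrite big1 // => d _; apply/eqP; rewrite eqb0; apply: contraFN cc.
    case/andP=> /and4P[_ -> _ /=]; rewrite !andbT => /and4P[ac _ bc _] /and3P[_ ca _].
    by rewrite /L ca ac Asym bc.
  case/andP: cc => cba Lc.
  have <- : \sum_(d | (d \notin [:: c; b; a]) && L d) 1 = #|L| - 1.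
    by rewrite card_notin /= ?Lc ?La ?Lb // cba bna.
  rewrite [RHS]big_mkcond; apply: eq_bigr => d _.
  rewrite /F /Q /top bna cba ba /=; case/and3P: Lc => -> ac cb.
  rewrite ac (Asym b c) cb (Asym b d) /L !andbT !andTb.
  by case: (d \notin _); case: (A a d); case: (A d b); case: (rank G d < rank G a).
(* In [F2], [F3] and [F4] the highest vertex is [b], [c] and [d]; symmetries of the 4-cycle give
   them all the same sum. *)
rewrite -FE; pose F2 a b c d := F b a c d; pose F3 a b c d := F c d a b.
pose F4 a b c d := F d c a b.
have s2 : sum4 F2 = sum4 F by exact: sum4_swap12.
have s3 : sum4 F3 = sum4 F.
  rewrite -(sum4_swap23 F) -(sum4_swap12 (fun a b c d => F a c b d)).
  rewrite -(sum4_swap34 (fun a b c d => F b c a d)).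
  by rewrite -(sum4_swap23 (fun a b c d => F b d a c)).
have s4 : sum4 F4 = sum4 F by rewrite -s3; exact: (sum4_swap34 F3).
have -> : inj4 [:: (0, 2); (0, 3); (1, 2); (1, 3)] =
    sum4 F + sum4 F2 + sum4 F3 + sum4 F4.
  rewrite /sum4 -!big_split; apply: eq_bigr => a _; rewrite -!big_split.
  apply: eq_bigr => b _; rewrite -!big_split; apply: eq_bigr => c _.
  rewrite -!big_split; apply: eq_bigr => d _; rewrite -/(Q a b c d) /F2 /F3 /F4 /F /=.
  rewrite (Q12 a b c d) (Q12 c d a b) -(Q1324 a b c d).
  case q : (Q c d a b) => //=; symmetry; apply: unique_top.
  move: q; rewrite Q1324 => /and4P[h1 h2 h3 _].
  rewrite -[uniq _]/(uniq (map (rank G) [:: a; b; c; d])) (map_inj_uniq (@rank_inj _ G)).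
  by rewrite -rev_uniq cons_uniq h3 cons_uniq h2 cons_uniq h1.
by rewrite s2 s3 s4; lia.
Qed.

End Patterns.

(** * From injective to induced counts *)

Definition pairs4 : seq (nat * nat) := [:: (0, 1); (0, 2); (0, 3); (1, 2); (1, 3); (2, 3)].

Definition below4 (P : seq (nat * nat)) : bool := all (fun e => (e.1 < 4) && (e.2 < 4)) P.

Definition relabel (s : seq nat) (P : seq (nat * nat)) : seq (nat * nat) :=
  [seq (nth 0 s e.1, nth 0 s e.2) | e <- P].

Definition sub_edges (P Q : seq (nat * nat)) : bool :=
  all (fun e => (e \in Q) || ((e.2, e.1) \in Q)) P.

(** The ten graphs on four vertices other than the complete graph. *)
Definition shapes : seq (seq (nat * nat)) :=
  [:: [::];
      [:: (0, 1)];
      [:: (0, 1); (0, 2)];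
      [:: (0, 1); (2, 3)];
      [:: (0, 1); (0, 2); (1, 2)];
      [:: (0, 1); (0, 2); (0, 3)];
      [:: (0, 1); (0, 2); (1, 3)];
      [:: (0, 1); (0, 2); (1, 2); (2, 3)];
      [:: (0, 2); (0, 3); (1, 2); (1, 3)];
      [:: (0, 1); (0, 2); (1, 2); (0, 3); (1, 3)]].

Definition isomorphic_via (b : seq bool) (k : nat) (s : seq nat) : bool :=
  let P := mask b pairs4 in let Q := relabel s (nth [::] shapes k) in
  sub_edges P Q && sub_edges Q P.

(** For the complete graph the search fails and returns 10; [leaf_expr] treats that case
    beforehand. *)
Definition shape_of (b : seq bool) : nat :=
  find (fun k => has (isomorphic_via b k) (permutations (iota 0 4))) (iota 0 10).

Fixpoint bitvectors (k : nat) : seq (seq bool) :=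
  if k is k'.+1 then
    [seq true :: b | b <- bitvectors k'] ++ [seq false :: b | b <- bitvectors k']
  else [:: [::]].

Lemma mem_bitvectors (b : seq bool) : b \in bitvectors (size b).
Proof.
elim: b => //= x b IH; rewrite mem_cat; case: x; apply/orP; [left|right];
  by apply/mapP; exists b.
Qed.

(** A finite check over the 64 subsets of [pairs4]. *)
Lemma shape_of_lt (b : seq bool) : size b = 6 -> b != nseq 6 true -> shape_of b < 10.
Proof.
move=> sb nb; have /allP/(_ b) : all (fun b => (b != nseq 6 true) ==> (shape_of b < 10))
  (bitvectors 6) by vm_compute.
by rewrite nb; apply; rewrite -sb mem_bitvectors.
Qed.

Section Counts.
Variables (n : nat) (G : sgraph n).
Let A := adj (edges G).
Implicit Type f : {ffun 'I_4 -> 'I_n}.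

Definition edge_image f (e : nat * nat) : bool := A (f (inord e.1)) (f (inord e.2)).

Definition injections (P : seq (nat * nat)) : nat :=
  #|[pred f : {ffun 'I_4 -> 'I_n} | injectiveb f && all (edge_image f) P]|.

Lemma edge_image_sym f x y : edge_image f (x, y) = edge_image f (y, x).
Proof. exact: adj_sym. Qed.

Lemma sub_edges_all f P Q : sub_edges P Q -> all (edge_image f) Q -> all (edge_image f) P.
Proof.
move=> /allP PQ /allP Qf; apply/allP => -[x y] /PQ /orP[]/Qf //.
by rewrite edge_image_sym.
Qed.

Lemma injections_eq P Q : sub_edges P Q -> sub_edges Q P -> injections P = injections Q.
Proof.
move=> PQ QP; apply: eq_card => f; rewrite !inE; congr (_ && _).
by apply/idP/idP; apply: sub_edges_all.
Qed.

Lemma enum_ord4 : enum 'I_4 = [:: inord 0; inord 1; inord 2; inord 3].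
Proof. by apply: (inj_map val_inj); rewrite val_enum_ord /= !inordK. Qed.

(** Precomposition with the permutation [g] given by [s] is a bijection on injective maps. *)
Lemma injections_relabel s P : perm_eq s (iota 0 4) -> below4 P ->
  injections (relabel s P) = injections P.
Proof.
move=> sp P4; pose g (i : 'I_4) : 'I_4 := inord (nth 0 s i).
have ss : size s = 4 by rewrite (perm_size sp).
have s4 i : i < 4 -> nth 0 s i < 4.
  move=> i4; have : nth 0 s i \in s by rewrite mem_nth ?ss.
  by rewrite (perm_mem sp) mem_iota.
have gI : injective g.
  move=> i j /(congr1 val); rewrite /= !inordK ?s4 // => /eqP.
  by rewrite nth_uniq ?ss // ?(perm_uniq sp) // => /eqP/val_inj.
pose h f : {ffun 'I_4 -> 'I_n} := [ffun i => f (g i)].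
have hI : injective h.
  move=> f1 f2 /ffunP E; apply/ffunP => i; have := E (invF gI i).
  by rewrite !ffunE f_invF.
have inj_h f : injectiveb (h f) = injectiveb f.
  apply/injectiveP/injectiveP => fI i j.
    move=> E; have := fI (invF gI i) (invF gI j); rewrite !ffunE !f_invF => /(_ E).
    exact: (can_inj (f_invF gI)).
  by rewrite !ffunE => /fI/gI.
have edge_h f : all (edge_image (h f)) P = all (edge_image f) (relabel s P).
  rewrite all_map; apply: eq_in_all => e /(allP P4)/andP[e1 e2].
  by rewrite /edge_image /= !ffunE /g !inordK.
rewrite /injections -!sum1_card [RHS](reindex h) /=; last exact: onW_bij (injF_bij hI).
by apply: eq_bigl => f; rewrite !inE inj_h edge_h.
Qed.

Lemma sum_ffun4 (F : 'I_n -> 'I_n -> 'I_n -> 'I_n -> nat) :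
  \sum_(f : {ffun 'I_4 -> 'I_n}) F (f (inord 0)) (f (inord 1)) (f (inord 2)) (f (inord 3)) =
  \sum_a \sum_b \sum_c \sum_d F a b c d.
Proof.
pose h (x : 'I_n * ('I_n * ('I_n * 'I_n))) : {ffun 'I_4 -> 'I_n} :=
  [ffun i : 'I_4 => nth x.1 [:: x.1; x.2.1; x.2.2.1; x.2.2.2] i].
pose h' f : 'I_n * ('I_n * ('I_n * 'I_n)) :=
  (f (inord 0), (f (inord 1), (f (inord 2), f (inord 3)))).
have hb : bijective h.
  exists h' => [[a [b [c d]]]|f]; first by rewrite /h' /h !ffunE /= !inordK.
  apply/ffunP => i; rewrite ffunE /=.
  have : i \in enum 'I_4 by rewrite mem_enum.
  by rewrite enum_ord4 !inE => /or4P[]/eqP->; rewrite inordK.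
rewrite (reindex h) /=; last exact: onW_bij.
under [RHS]eq_bigr => a _.
  under eq_bigr => b _ do rewrite pair_big.
  rewrite pair_big; over.
rewrite pair_big; apply: eq_bigr => -[a [b [c d]]] _ /=.
by rewrite !ffunE /= !inordK.
Qed.

Lemma injections_inj4 P : below4 P -> injections P = inj4 G P.
Proof.
move=> P4; rewrite /injections -sum1_card big_mkcond /inj4 -sum_ffun4.
apply: eq_bigr => f _; rewrite !inE -/(nat_of_bool _).
have -> : injectiveb f = uniq (rev [seq f i | i <- enum 'I_4]) by rewrite rev_uniq.
have -> : all (edge_image f) P =
    respects G (f (inord 0), f (inord 1), f (inord 2), f (inord 3)) P.
  apply: eq_in_all => -[i j] /(allP P4) /= /andP[i4 j4]; rewrite /edge_image /=.
  by case: i i4 => [|[|[|[|//]]]] _; case: j j4 => [|[|[|[|//]]]] _.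
move: (respects _ _ _) => r; rewrite enum_ord4 /= !inE andbT.
set x := f _; set y := f _; set z := f _; set w := f _.
by case: (z != w); case: ((y == z) || (y == w)); case: [|| x == y, x == z | x == w]; case: r.
Qed.

(** [Some true] asks for an edge at the corresponding pair of [pairs4],
    [Some false] for a non-edge and [None] for nothing. *)
Definition meets (st : seq (option bool)) f : bool :=
  all (fun x => if x.1 is Some b then edge_image f x.2 == b else true) (zip st pairs4).

Definition mixed_count (st : seq (option bool)) : nat :=
  #|[pred f : {ffun 'I_4 -> 'I_n} | injectiveb f && meets st f]|.

(** A free pair is an edge or a non-edge. Both the inclusion-exclusion and the completion of
    [Htilde] rest on this. The length bound keeps [zip] from cutting off the free position. *)
Lemma mixed_count_split st1 st2 : size st1 + size st2 < 6 ->
  mixed_count (st1 ++ None :: st2) =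
  mixed_count (st1 ++ Some true :: st2) + mixed_count (st1 ++ Some false :: st2).
Proof.
move=> sz; pose e := nth (0, 0) pairs4 (size st1).
have zipE o : zip (st1 ++ o :: st2) pairs4 =
    zip st1 (take (size st1) pairs4) ++
    (o, e) :: zip st2 (drop (size st1).+1 pairs4).
  rewrite -[pairs4 in LHS](cat_take_drop (size st1)) (drop_nth (0, 0)) /=; last by lia.
  by rewrite zip_cat // size_takel //=; lia.
rewrite /mixed_count -(cardID [pred f | edge_image f e]) /=.
congr (_ + _); apply: eq_card => f; rewrite !inE /meets !zipE !all_cat /=.
  by case: (edge_image f e); rewrite ?andbF ?andbT.
by case: (edge_image f e); rewrite ?andbF ?andbT.
Qed.

(** A false bit leaves its pair free, which gives injective homomorphisms; with [Some] in place of
    [required] it would forbid the edge and give induced embeddings. *)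
Definition required (b : bool) : option bool := if b then Some true else None.

Lemma mixed_count_required b :
  mixed_count (map required b) = injections (mask b pairs4).
Proof.
apply: eq_card => f; rewrite !inE; congr (_ && _); rewrite /meets.
elim: b pairs4 => [|x b IH] [|e P] //=.
by case: x => /=; rewrite IH ?eqb_id.
Qed.

Lemma mixed_count_leq st : mixed_count st <= n ^ 4.
Proof.
by apply: leq_trans (max_card _) _; rewrite card_ffun !card_ord.
Qed.

Lemma injections_shape b : size b = 6 -> b != nseq 6 true ->
  injections (mask b pairs4) = inj4 G (nth [::] shapes (shape_of b)).
Proof.
move=> sb nb; have lt := shape_of_lt sb nb.
have : has (fun k => has (isomorphic_via b k) (permutations (iota 0 4))) (iota 0 10).
  by rewrite has_find.
move/(nth_find 0); rewrite -/(shape_of b) nth_iota // add0n => /hasP[s].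
rewrite mem_permutations => sp /andP[h1 h2].
rewrite (injections_eq h1 h2).
have w : below4 (nth [::] shapes (shape_of b)).
  by have /allP := (isT : all below4 shapes); apply; rewrite mem_nth.
by rewrite injections_relabel // injections_inj4.
Qed.

End Counts.

(** * Induced copies as embeddings up to automorphisms *)

Section Copies.
Variables (n : nat) (G : sgraph n).

Definition bits (H : sgraph 4) : seq bool :=
  [seq adj (edges H) (inord e.1) (inord e.2) | e <- pairs4].

Definition embedding k (H : sgraph k) (f : {ffun 'I_k -> 'I_n}) : bool :=
  injectiveb f && [forall x, forall y, adj (edges H) x y == adj (edges G) (f x) (f y)].

Lemma meets_bits (H : sgraph 4) (f : {ffun 'I_4 -> 'I_n}) :
  meets G (map Some (bits H)) f =
  [forall x, forall y, adj (edges H) x y == adj (edges G) (f x) (f y)].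
Proof.
have -> : meets G (map Some (bits H)) f = all (fun e =>
    adj (edges G) (f (inord e.1)) (f (inord e.2)) ==
    adj (edges H) (inord e.1) (inord e.2)) pairs4.
  by rewrite /meets /bits; elim: pairs4 => //= e P ->.
apply/allP/forallP => [h x|h e _]; last first.
  by have /forallP/(_ (inord e.2)) := h (inord e.1); rewrite eq_sym.
apply/forallP => y.
have hs e : (e \in pairs4) || ((e.2, e.1) \in pairs4) ->
    adj (edges H) (inord e.1) (inord e.2) ==
    adj (edges G) (f (inord e.1)) (f (inord e.2)).
  case/orP => /h; first by rewrite eq_sym.
  by rewrite /= ![adj _ _ (_ (inord e.1))]adj_sym [adj _ _ (inord e.1)]adj_sym eq_sym.
have [->|xy] := eqVneq x y; first by rewrite !adj_irr.
rewrite -[x]inord_val -[y]inord_val; apply: (hs (val x, val y)).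
move: xy (ltn_ord x) (ltn_ord y); rewrite -val_eqE /=.
by case: (val x) (val y) => [|[|[|[|i]]]] [|[|[|[|j]]]].
Qed.

Lemma mixed_count_bits (H : sgraph 4) :
  mixed_count G (map Some (bits H)) = #|[pred f : {ffun 'I_4 -> 'I_n} | embedding H f]|.
Proof. by apply: eq_card => f; rewrite !inE meets_bits. Qed.

End Copies.

(** Fix one embedding [f0] onto [S]. Every other one is [f0] after a unique automorphism of [H]. *)
Lemma embedding_fibre k n (H : sgraph k) (G : sgraph n) S : S \in induced_copies H G ->
  #|[pred f : {ffun 'I_k -> 'I_n} | embedding G H f && (f @: [set: 'I_k] == S)]| =
  #|[pred f : {ffun 'I_k -> 'I_k} | embedding H H f]|.
Proof.
rewrite inE => /existsP[f0 /and3P[/injectiveP f0I /eqP f0S /forallP f0E]].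
pose h (g : {ffun 'I_k -> 'I_k}) : {ffun 'I_k -> 'I_n} := [ffun i => f0 (g i)].
have hI : injective h.
  by move=> g1 g2 /ffunP E; apply/ffunP => i; have := E i; rewrite !ffunE => /f0I.
rewrite -(card_image hI); apply: eq_card => f; apply/idP/imageP.
  case/andP => /andP[/injectiveP fI /forallP fE] /eqP fS.
  have fx i : exists j, f i == f0 j.
    have : f i \in S by rewrite -fS imset_f ?inE.
    by rewrite -f0S => /imsetP[j _ ->]; exists j.
  pose g : {ffun 'I_k -> 'I_k} := [ffun i => xchoose (fx i)].
  have gE i : f0 (g i) = f i by rewrite ffunE; rewrite -(eqP (xchooseP (fx i))).
  exists g; last by apply/ffunP => i; rewrite ffunE gE.
  rewrite inE; apply/andP; split.
    by apply/injectiveP => i j E; apply: fI; rewrite -!gE E.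
  apply/forallP => i; apply/forallP => j.
  have /forallP/(_ (g j))/eqP -> := f0E (g i); rewrite !gE.
  by have /forallP/(_ j) := fE i.
case=> g; rewrite inE => /andP[/injectiveP gI /forallP gE] ->.
rewrite inE; apply/andP; split; last first.
  apply/eqP; rewrite -f0S; apply/setP => y; apply/imsetP/imsetP => -[i _ ->].
    by exists (g i); rewrite ?inE // ffunE.
  by exists (invF gI i); rewrite ?inE // ffunE f_invF.
apply/andP; split; first by apply/injectiveP => i j; rewrite !ffunE => /f0I/gI.
apply/forallP => i; apply/forallP => j; rewrite !ffunE.
have /forallP/(_ j)/eqP -> := gE i.
by have /forallP/(_ (g j)) := f0E (g i).
Qed.

Lemma card_embeddings k n (H : sgraph k) (G : sgraph n) :
  #|[pred f : {ffun 'I_k -> 'I_n} | embedding G H f]| =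
  #|induced_copies H G| * #|[pred f : {ffun 'I_k -> 'I_k} | embedding H H f]|.
Proof.
have im f : embedding G H f -> f @: [set: 'I_k] \in induced_copies H G.
  by move=> /andP[fI fE]; rewrite inE; apply/existsP; exists f; rewrite fI fE eqxx.
rewrite -[LHS]sum1_card -sum_nat_const.
rewrite (partition_big (fun f : {ffun 'I_k -> 'I_n} => f @: [set: 'I_k]) _ im) /=.
apply: eq_bigr => S SG.
by rewrite -(embedding_fibre SG) -[RHS]sum1_card.
Qed.

Lemma automorphisms_gt0 k (H : sgraph k) :
  0 < #|[pred f : {ffun 'I_k -> 'I_k} | embedding H H f]|.
Proof.
apply/card_gt0P; exists [ffun i => i]; rewrite inE; apply/andP; split.
  by apply/injectiveP => i j; rewrite !ffunE.
by apply/forallP => i; apply/forallP => j; rewrite !ffunE.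
Qed.

(** * The combined program *)

Section FinalCode.
Variable R : nat -> nat.

(** The entries follow the order of [shapes]. The two differences of totals come from
    [inj4_matching] and [inj4_path]; the factor 4 for the 4-cycle is the choice of the position of
    its highest vertex. *)
Definition shape_exprs : seq expr :=
  let N := Reg (R 15) in
  let m := Reg (R 7) in
  [:: Op Mul N (Op Mul (minus N 1) (Op Mul (minus N 2) (minus N 3)));
      Op Mul m (Op Mul (minus N 2) (minus N 3));
      Op Mul (Reg (R 8)) (minus N 3);
      Op Defs.Sub (Op Mul m m) (Op Add (Op Mul (Const 4) (Reg (R 8))) (Op Mul (Const 2) m));
      Op Mul (Reg (R 11)) (minus N 3);
      Reg (R 9);
      Op Defs.Sub (Reg (R 10)) (Reg (R 11));
      Reg (R 12);
      Op Mul (Const 4) (Reg (R 14));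
      Reg (R 13)].

(** Register [R 16] is to contain the count for the complete graph. *)
Definition leaf_expr (b : seq bool) : expr :=
  if b == nseq 6 true then Reg (R 16) else nth (Const 0) shape_exprs (shape_of b).

(** Inclusion-exclusion as an expression: [b] holds the pairs already decided, and a non-edge is the
    free count minus the count with the edge. *)
Fixpoint mixed_expr (b : seq bool) (st : seq (option bool)) : expr :=
  match st with
  | [::] => leaf_expr b
  | Some true :: st' => mixed_expr (rcons b true) st'
  | None :: st' => mixed_expr (rcons b false) st'
  | Some false :: st' =>
      Op Defs.Sub (mixed_expr (rcons b false) st') (mixed_expr (rcons b true) st')
  end.

(** From the count [e] for the graph whose first [k] pairs are edges and whose
    other pairs are described by [b], turn the non-edges into edges one by one. *)
Fixpoint complete_expr (k : nat) (b : seq bool) (e : expr) : expr :=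
  match b with
  | [::] => e
  | true :: b' => complete_expr k.+1 b' e
  | false :: b' => complete_expr k.+1 b'
      (Op Defs.Sub (mixed_expr [::] (nseq k (Some true) ++ None :: map Some b')) e)
  end.

Definition automorphisms (H : sgraph 4) : nat :=
  #|[pred f : {ffun 'I_4 -> 'I_4} | embedding H H f]|.

(** Names 7 to 14 hold the totals, 15 the order of the graph and 16 the count for the complete
    graph. *)
Definition output_register (H : sgraph 4) : nat := R (17 + enum_rank H).

Definition output_code (Hs : seq (sgraph 4)) : prog :=
  foldr (fun H q => Seq (Assign (output_register H)
    (Op Div (mixed_expr [::] (map Some (bits H))) (Const (automorphisms H)))) q) Skip Hs.

Definition solve_code (Htilde : sgraph 4) (r : nat) : prog :=
  Assign (R 16) (complete_expr 0 (bits Htilde)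
    (Op Mul (Const (automorphisms Htilde)) (Reg r))).

Variables (n : nat) (G : sgraph n) (nb : 'I_n -> seq 'I_n).
Hypothesis nbG : adjacency_lists G nb.
Hypothesis RE : forall i j, (R i == R j) = (i == j).

Definition totals (j : nat) : nat :=
  nth 0 [:: deg_sum G (enum 'I_n); cherry_sum G (enum 'I_n); claw_sum G (enum 'I_n);
    path_sum G (all_pairs G nb); triangle_sum G (all_triples G nb);
    paw_sum G (all_triples G nb); diamond_sum G (all_triples G nb);
    square_sum G (all_triples G nb); n; mixed_count G (nseq 6 (Some true))] (j - 7).

(** The bound [k] is 16 before the count for the complete graph is known and 17 afterwards. *)
Definition has_totals (k : nat) (s : state) : Prop :=
  forall j, 7 <= j < k -> reg s (R j) = totals j.

Lemma eval_shape s i : has_totals 16 s -> i < 10 ->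
  evaln s (nth (Const 0) shape_exprs i) = inj4 G (nth [::] shapes i).
Proof.
move=> hs; have [e7 e8 e9 e10 e11] : [/\ reg s (R 7) = \sum_v deg G v,
   reg s (R 8) = \sum_v deg G v * (deg G v - 1),
   reg s (R 9) = \sum_v deg G v * ((deg G v - 1) * (deg G v - 2)),
   reg s (R 10) = \sum_v \sum_(u | adj (edges G) v u) (deg G v - 1) * (deg G u - 1) &
   reg s (R 11) = \sum_v \sum_(u | adj (edges G) v u) common G v u].
  by split; rewrite hs // /totals /= ?total_deg ?total_cherry ?total_claw
    ?(total_path nbG) ?(total_triangle nbG).
have e12 := hs 12 isT; have e13 := hs 13 isT; have e14 := hs 14 isT.
rewrite /totals /= ?(total_paw nbG) ?(total_diamond nbG) ?(total_square nbG) in e12 e13 e14.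
have e15 : reg s (R 15) = n by exact: hs.
case: i => [|[|[|[|[|[|[|[|[|[|i]]]]]]]]]] // _; rewrite [nth _ _ _]/= [nth _ _ _]/=.
- by rewrite inj4_empty /= e15.
- by rewrite inj4_edge /= e7 e15.
- by rewrite inj4_cherry /= e8 e15.
- by rewrite /= e7 e8 -inj4_matching addnK.
- by rewrite inj4_triangle /= e11 e15.
- by rewrite inj4_claw.
- by rewrite /= e10 e11 -inj4_path addnK.
- by rewrite inj4_paw.
- by rewrite inj4_square /= e14.
- by rewrite inj4_diamond.
Qed.

Lemma eval_leaf s b k : has_totals k s -> 16 <= k -> size b = 6 ->
  (b != nseq 6 true) || (16 < k) -> evaln s (leaf_expr b) = mixed_count G (map required b).
Proof.
move=> hs k16 sb; rewrite /leaf_expr; case: eqVneq => [-> /= k17|b6 _].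
  by rewrite hs.
rewrite eval_shape ?shape_of_lt //; last by move=> j /andP[j7 j16]; apply: hs; lia.
by rewrite mixed_count_required injections_shape.
Qed.

(** A free pair turns into a false bit at every leaf, so the leaf for the complete graph is never
    reached; otherwise its count must already be known. *)
Lemma eval_mixed s b st k : has_totals k s -> 16 <= k -> size b + size st = 6 ->
  [|| false \in b, None \in st | 16 < k] ->
  evaln s (mixed_expr b st) = mixed_count G (map required b ++ st).
Proof.
move=> hs k16; elim: st b => [|o st IH] b /=.
  rewrite addn0 cats0 /= => sb h; apply: (@eval_leaf s b k) => //.
  move: h => /orP[fb|->]; last by rewrite orbT.
  by apply/orP; left; apply: contraTneq fb => ->.
move=> sz; have sz' x : size (rcons b x) + size st = 6 by rewrite size_rcons addSnnS.
have E x : map required (rcons b x) ++ st = map required b ++ required x :: st.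
  by rewrite map_rcons cat_rcons.
have fr x : (false \in rcons b x) = (x == false) || (false \in b).
  by rewrite mem_rcons inE eq_sym.
case: o => [[]|]; rewrite inE /= => h.
- by rewrite IH ?E // fr.
- have h' : [|| false \in b, None \in st | 16 < k] by [].
  rewrite !IH ?E ?fr //= mixed_count_split ?size_map; last by lia.
  by rewrite addKn.
- by rewrite IH ?E // fr.
Qed.

Lemma eval_complete s k b e : has_totals 16 s -> k + size b = 6 ->
  evaln s e = mixed_count G (nseq k (Some true) ++ map Some b) ->
  evaln s (complete_expr k b e) = mixed_count G (nseq 6 (Some true)).
Proof.
move=> hs; elim: b k e => [|x b IH] k e /=.
  by rewrite addn0 cats0 => ->.
have E (o : option bool) : nseq k o ++ o :: map Some b = nseq k.+1 o ++ map Some b.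
  by rewrite -cat_rcons; congr (_ ++ _); elim: k {IH} => //= k ->.
move=> sz he; case: x he => he; apply: IH; try by lia.
  by rewrite -E.
rewrite /= (eval_mixed hs) //=; first last.
- by rewrite mem_cat inE eqxx orbT.
- by rewrite size_cat size_nseq /= size_map.
rewrite mixed_count_split ?size_nseq ?size_map; last by lia.
by rewrite he addnK E.
Qed.

Lemma eval_output s H : has_totals 17 s ->
  evaln s (Op Div (mixed_expr [::] (map Some (bits H))) (Const (automorphisms H))) =
  #|induced_copies H G|.
Proof.
move=> hs.
rewrite -[LHS]/(evaln s (mixed_expr [::] (map Some (bits H))) %/ automorphisms H).
rewrite (eval_mixed hs) ?orbT ?size_map // [map _ [::]]/=.
by rewrite mixed_count_bits card_embeddings mulnK // automorphisms_gt0.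
Qed.

Lemma has_totals_reg k s j x : k <= j -> has_totals k s -> has_totals k (set_reg s (R j) x).
Proof.
by move=> kj hs i /andP[i7 ik] /=; rewrite RE; case: eqP => [?|_]; [lia | apply: hs; lia].
Qed.

Lemma copies_leq (H : sgraph 4) : #|induced_copies H G| <= n ^ 4.
Proof.
apply: leq_trans (mixed_count_leq G (map Some (bits H))).
by rewrite mixed_count_bits card_embeddings leq_pmulr // automorphisms_gt0.
Qed.

(** [P] collects the graphs whose results are already written, so that the induction records that
    later assignments, to other registers, do not spoil them. *)
Lemma wp_output X s (Hs : seq (sgraph 4)) (P : pred (sgraph 4)) : n ^ 4 <= X ->
  has_totals 17 s -> (forall H, P H -> reg s (output_register H) = #|induced_copies H G|) ->
  wp X (output_code Hs) s (fun s' => forall H, P H || (H \in Hs) ->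
    reg s' (output_register H) = #|induced_copies H G|).
Proof.
move=> nX; elim: Hs s P => [|H Hs IH] s P hs hP.
  by move=> H; rewrite orbF; exact: hP.
have ev := eval_output H hs.
rewrite /= -/(output_code Hs); split; first by move: ev => /= ->; exact: leq_trans (copies_leq H) nX.
move: ev => /= ->.
apply: (@wp_weaken _ _ _ (fun s' => forall H', (P H' || (H' == H)) || (H' \in Hs) ->
    reg s' (output_register H') = #|induced_copies H' G|)).
  by move=> s' h H' hH'; apply: h; rewrite -orbA -in_cons.
apply: (IH _ (fun H' => P H' || (H' == H))); first exact: has_totals_reg.
move=> H' PH' /=; rewrite RE eqn_add2l val_eqE (inj_eq enum_rank_inj).
by case: eqP PH' => [-> _|_] //; rewrite orbF => /hP.
Qed.

End FinalCode.

(** * Running the given program between the counting code and the final arithmetic *)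

Fixpoint writes_above (b : nat) (p : prog) : bool :=
  match p with
  | Skip => true
  | Assign x _ => b <= x
  | Store a _ _ => b <= a
  | Seq p q => writes_above b p && writes_above b q
  | If _ p q => writes_above b p && writes_above b q
  | While _ p => writes_above b p
  end.

Lemma exec_writes_above B b p s k s' : exec B p s k s' -> writes_above b p ->
  agree_below b s s'.
Proof.
have trans s1 s2 s3 : agree_below b s1 s2 -> agree_below b s2 s3 -> agree_below b s1 s3.
  by case=> h1 h2 [h3 h4]; split=> [r rb|a ab i]; rewrite ?h1 ?h2 ?h3 ?h4.
elim=> {p s k s'} //=.
- by move=> x e s v _ bx; split=> // r rb /=; case: eqP => // ?; lia.
- by move=> a e1 e2 s i v _ _ ba; split=> // a' ab j /=; case: eqP => // ?; lia.
- by move=> p q s k s' l s'' _ IHp _ IHq /andP[/IHp h1 /IHq h2]; exact: trans h1 h2.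
- by move=> e p q s v k s' _ _ _ IHp /andP[/IHp].
- by move=> e p q s k s' _ _ IHq /andP[_ /IHq].
- by move=> e p s v k s' l s'' _ _ _ IHp _ IHw h; exact: trans (IHp h) (IHw h).
Qed.

Lemma fill_count_writes_above R b : (forall j, b <= R j) ->
  writes_above b (Seq (fill_code R) (count_code R)).
Proof. by move=> bR; rewrite /= !bR. Qed.

Section Combine.
Variables (Htilde : sgraph 4) (p0 : prog) (r0 c0 : nat).

(** The output register [r0] is included because the given program need not mention it; the 2
    protects the arrays of the input. *)
Let base := maxn (prog_bound p0) (maxn r0.+1 2).
Definition fresh (j : nat) : nat := base + j.
Let R := fresh.

Lemma fresh_eq i j : (R i == R j) = (i == j).
Proof. by rewrite /R /fresh eqn_add2l. Qed.

Lemma fresh_ge2 i : 2 <= R i.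
Proof. by rewrite /R /fresh /base; lia. Qed.

(** The order of the graph is copied, as the given program may overwrite register 0. *)
Definition prepare_code : prog :=
  Seq (Seq (fill_code R) (count_code R)) (Assign (R 15) (Reg 0)).

Definition finish_code : prog :=
  Seq (solve_code R Htilde r0) (output_code R (enum {: sgraph 4})).

(** The given program leaves values as large as [(n + 2) ^ c0], and its state must be small when the
    final arithmetic starts. *)
Let D := maxn c0 12.
(** 68 is [4 * 12 + 20], the requirement of the counting code for stored values of degree 12. *)
Definition word_exponent : nat := maxn 68 (maxn D (prog_degree D finish_code)).
Let c := word_exponent.

Lemma ok_prepare n (G : sgraph n) nb : adjacency_lists G nb ->
  ok ((n + 2) ^ c) prepare_code (input_state nb)
    (500 * (n + arboricity G * #|edges G|) + 14)
    (fun s => small ((n + 2) ^ D) s /\ has_totals R G nb 16 s).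
Proof.
move=> nbG; have M1 : 1 < n + 2 by lia.
have nM : n.+1 < n + 2 by lia.
have c68 : 4 * 12 + 20 <= c by rewrite /c /word_exponent leq_maxl.
have H := ok_fill_count nbG fresh_eq fresh_ge2 nM (leqnn 12) c68.
apply: (@ok_weaken _ _ _ (500 * (n + arboricity G * #|edges G|) + 12 + 2) _
  (fun s => small ((n + 2) ^ D) s /\ has_totals R G nb 16 s)) => //; last by lia.
apply: ok_seq; apply: ok_weaken H _ _ => // s [sm [hin _ _ _ h7 h8 h9 h10 h11 h12 h13 h14]].
have nX : n <= (n + 2) ^ 12 by apply: (@poly_leq n (n + 2) 12 nM isT 1); rewrite ?expn1; lia.
have d15 : prog_degree 12 (Assign (R 15) (Reg 0)) <= c by rewrite /=; lia.
have w : wp ((n + 2) ^ 12) (Assign (R 15) (Reg 0)) s (has_totals R G nb 16).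
  split; rewrite /= hin.1 // => j /andP[j7 j16] /=; rewrite fresh_eq.
  case: eqP => [->//|j15]; rewrite /totals.
  have : j < 15 by lia.
  by case: j j7 {j16 j15} => [|[|[|[|[|[|[|[|[|[|[|[|[|[|[|j]]]]]]]]]]]]]]].
apply: ok_weaken (ok_wp M1 sm d15 w) _ _ => // s' [sm' ht]; split=> //.
by apply: small_leq sm'; rewrite leq_exp2l // /D leq_maxr.
Qed.

Lemma ok_finish n (G : sgraph n) nb s : adjacency_lists G nb ->
  small ((n + 2) ^ D) s -> has_totals R G nb 16 s ->
  reg s r0 = #|induced_copies Htilde G| ->
  ok ((n + 2) ^ c) finish_code s (max_cost finish_code)
    (fun s' => forall H, reg s' (output_register R H) = #|induced_copies H G|).
Proof.
move=> nbG sm ht hr; have M1 : 1 < n + 2 by lia.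
have n4 : n ^ 4 <= (n + 2) ^ D.
  apply: (@leq_trans ((n + 2) ^ 4)); first by rewrite leq_exp2r //; lia.
  by rewrite leq_exp2l // /D; lia.
have dc : prog_degree D finish_code <= c by rewrite /c /word_exponent; lia.
suff w : wp ((n + 2) ^ D) finish_code s
    (fun s' => forall H, reg s' (output_register R H) = #|induced_copies H G|).
  by apply: ok_weaken (ok_wp M1 sm dc w) _ _ => // s' [].
have ev : evaln s (complete_expr R 0 (bits Htilde)
    (Op Mul (Const (automorphisms Htilde)) (Reg r0))) = mixed_count G (nseq 6 (Some true)).
  apply: (eval_complete nbG ht) => //.
  by rewrite /= hr mixed_count_bits card_embeddings mulnC.
split; first by rewrite ev; exact: leq_trans (mixed_count_leq _ _) n4.
rewrite ev; apply: (@wp_weaken _ _ _ (fun s' => forall H, xpred0 H || (H \in enum {: sgraph 4}) ->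
    reg s' (output_register R H) = #|induced_copies H G|)).
  by move=> s' h H; apply: h; rewrite mem_enum.
apply: (wp_output nbG fresh_eq) => // j /andP[j7 j17] /=; rewrite fresh_eq.
by case: eqP => [->|j16] //; apply: ht; lia.
Qed.

Lemma combine_correct n (G : sgraph n) nb k0 s0 : adjacency_lists G nb ->
  exec ((n + 2) ^ c0) p0 (input_state nb) k0 s0 ->
  reg s0 r0 = #|induced_copies Htilde G| ->
  ok ((n + 2) ^ c) (Seq prepare_code (Seq p0 finish_code)) (input_state nb)
    (500 * (n + arboricity G * #|edges G|) + 14 + (k0 + max_cost finish_code))
    (fun s => forall H, reg s (output_register R H) = #|induced_copies H G|).
Proof.
move=> nbG ex0 hr; have [k1 [s1 [ex1 k1le [sm1 ht1]]]] := ok_prepare nbG.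
have above : writes_above base prepare_code.
  rewrite /= -/(writes_above base (Seq _ _)).
  by apply/andP; split; [apply: fill_count_writes_above => j|]; rewrite /R /fresh leq_addr.
have agr := exec_writes_above ex1 above.
have pb : prog_bound p0 <= base by rewrite /base leq_maxl.
have [s2 [ex2 [agr2 _] [abv _]]] := exec_frame ex0 pb agr.
have cc0 : c0 <= c by rewrite /c /word_exponent /D; lia.
have M1 : 1 < n + 2 by lia.
have sm2 : small ((n + 2) ^ D) s2.
  by apply: exec_small ex2 sm1; rewrite leq_exp2l // /D leq_maxl.
have ht2 : has_totals R G nb 16 s2.
  by move=> j hj; rewrite abv ?ht1 // /R /fresh leq_addr.
have hr2 : reg s2 r0 = #|induced_copies Htilde G|.
  by rewrite -agr2 // /base; lia.
have [k3 [s3 [ex3 k3le q3]]] := ok_finish nbG sm2 ht2 hr2.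
exists (k1 + (k0 + k3)), s3; split=> //; last by rewrite leq_add // leq_add.
apply: ExecSeq ex1 _; apply: ExecSeq ex3.
by apply: exec_mono ex2; rewrite leq_exp2l.
Qed.

End Combine.

Import Order.TTheory GRing.Theory Num.Theory.

Theorem theorem2 (R : realType) (t : forall n : nat, sgraph n -> R)
    (t_ge0 : forall (n : nat) (G : sgraph n), (0 <= t n G)%R)
    (Htilde : sgraph 4) :
  counts_induced_in_time [set Htilde] t ->
  counts_induced_in_time [set: sgraph 4]
    (fun (n : nat) (G : sgraph n) =>
       n%:R + (arboricity G)%:R * #|edges G|%:R + t n G)%R.
Proof.
move=> [p0 [out [c0 [C [C0 h]]]]].
(* Since the given run takes [k0 >= 1] steps, the constant [14 + max_cost] is at most that many
   times [k0]; one further [k0] pays for the run itself. *)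
pose r0 := out Htilde; pose K := 15 + max_cost (finish_code Htilde p0 r0).
exists (Seq (prepare_code p0 r0) (Seq p0 (finish_code Htilde p0 r0))).
exists (output_register (fresh p0 r0)), (word_exponent Htilde p0 r0 c0).
exists (500%:R + K%:R * C)%R; split.
  by rewrite ltr_wpDr // ?mulr_ge0 ?ler0n ?ltr0n // ltW.
move=> n G nb nbG; have [k0 [s0 [ex0 k0t hr]]] := h n G nb nbG.
have hr0 := hr Htilde (set11 _).
have [k [s [ex kle q]]] := combine_correct nbG ex0 hr0.
exists k, s; split=> // {q ex}.
have k0_gt0 := exec_gt0 ex0.
set w := n + arboricity G * #|edges G| in kle.
have kle' : k <= 500 * w + K * k0.
  apply: leq_trans kle _; rewrite -addnA leq_add2l /K -/r0.
  move: (max_cost _) => mc; have := leq_pmulr (14 + mc) k0_gt0.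
  by rewrite -[15 + mc]/((14 + mc).+1) mulSn; lia.
have {kle kle'} hk : (k%:R <= 500%:R * w%:R + K%:R * k0%:R :> R)%R.
  by rewrite -!natrM -natrD ler_nat.
rewrite -natrM -natrD -/w; apply: le_trans hk _.
have Kt : (K%:R * k0%:R <= K%:R * C * t n G)%R by rewrite -mulrA ler_wpM2l.
have w0 : (0 <= w%:R :> R)%R by [].
have KC : (0 <= K%:R * C)%R by rewrite mulr_ge0 // ltW.
have t0 := t_ge0 n G.
have h1 : (0 <= 500%:R * t n G)%R by rewrite mulr_ge0.
have h2 : (0 <= K%:R * C * w%:R)%R by rewrite mulr_ge0.
move: (500%:R : R)%R h1 => a h1.
move: (K%:R : R)%R Kt KC h2 => b Kt KC h2; rewrite mulrDl !mulrDr.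
by apply: lerD; [rewrite lerDl | apply: le_trans Kt _; rewrite lerDr].
Qed.
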